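(* Let $(M,\Omega)$ be a symplectic manifold. A symplectic connection $\nabla$ on $(M,\Omega)$ has constant symplectic sectional curvature if and only if it is Weyl flat with parallel Ricci tensor, in which case it is locally symmetric (that is, its curvature tensor is parallel).
   Context: $M$ is smooth and connected, of dimension $2n\ge 2$. Abstract index notation with the summation convention is used; parentheses (brackets) around indices denote normalized complete symmetrization (antisymmetrization), e.g. $a_{(ij)}=\tfrac12(a_{ij}+a_{ji})$. An affine connection $\nabla$ on $(M,\Omega)$ is symplectic if it is torsion-free and $\nabla\Omega=0$. Its curvature is $R(X,Y)Z=\nabla_X\nabla_YZ-\nabla_Y\nabla_XZ-\nabla_{[X,Y]}Z$, in indices $2\nabla_{[i}\nabla_{j]}X^k=R_{ijp}{}^kX^p$. Set $R_{ijkl}=R_{ijk}{}^p\Omega_{pl}$, so $X^iY^jZ^kU^lR_{ijkl}=\Omega(R(X,Y)Z,U)$. The Ricci tensor is $R_{ij}=R_{pij}{}^p$ (it is symmetric). The symplectic Weyl tensor is $$W_{ijkl}=R_{ijkl}-\tfrac{1}{n+1}\left(\Omega_{i(k}R_{l)j}-\Omega_{j(k}R_{l)i}+\Omega_{ij}R_{kl}\right),$$ and $\nabla$ is Weyl flat if $W_{ijkl}=0$. A two-dimensional subspace $L\subset T_pM$ is symplectic if $\Omega|_L$ is nondegenerate. For such $L$ the quadratic form $\mathscr{K}_{p,L}$ is $\mathscr{K}_{p,L}(Z)=\Omega(R(X,Y)Z,Z)/\Omega(X,Y)$ for any basis $X,Y$ of $L$ (independent of the choice). The symplectic sectional curvature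 of $L$ is the restriction of $\mathscr{K}_{p,L}$ to $L$. $\nabla$ has constant symplectic sectional curvature if there is a $\nabla$-parallel symmetric covariant two-tensor $A_{ij}$ such that for all $p\in M$ and all two-dimensional symplectic $L\subset T_pM$ the symplectic sectional curvature of $L$ equals the restriction to $L$ of the quadratic form $Z\mapsto A(Z,Z)$. *)

(* Defs.v *)
From HB Require Import structures.
From mathcomp Require Import all_boot all_order all_algebra.
From mathcomp Require Import all_classical all_reals all_analysis.
From mathcomp Require Import ring.

Set Implicit Arguments.
Unset Strict Implicit.
Unset Printing Implicit Defensive.

Import Order.TTheory GRing.Theory Num.Theory.
Import numFieldNormedType.Exports.

Local Open Scope classical_set_scope.
Local Open Scope ring_scope.

Definition pderiv (R : realType) (m : nat) (a : 'I_m) (f : 'rV[R]_m -> R) :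
    'rV[R]_m -> R :=
  fun x => 'D_(delta_mx 0 a) f x.

(** [D] is meant to be open: every iterated partial derivative of [f]
    (including [f] itself, for [s = [::]]) is Frechet differentiable on [D]. *)
Definition smooth_on (R : realType) (m : nat) (D : set 'rV[R]_m)
    (f : 'rV[R]_m -> R) : Prop :=
  forall (s : seq 'I_m) (x : 'rV[R]_m), D x ->
    differentiable (foldr (@pderiv R m) f s) x.

(** A connected smooth manifold of dimension [m], given by a smooth atlas. The
    chart [chart i] is a homeomorphism from the open set [chart_dom i] onto an
    open subset of R^m, with inverse [chart_inv i]; values outside these sets
    are irrelevant. *)
Record smooth_manifold (R : realType) (m : nat) := SmoothManifold {
  mcarrier :> topologicalType ;
  m_hausdorff : hausdorff_space mcarrier ;
  m_second_countable : @second_countable mcarrier ;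
  m_connected : connected [set: mcarrier] ;
  chart_idx : Type ;
  chart_dom : chart_idx -> set mcarrier ;
  chart : chart_idx -> mcarrier -> 'rV[R]_m ;
  chart_inv : chart_idx -> 'rV[R]_m -> mcarrier ;
  chart_cover : forall p, exists i, chart_dom i p ;
  chart_dom_open : forall i, open (chart_dom i) ;
  chart_img_open : forall i, open (chart i @` chart_dom i) ;
  chartK : forall i p, chart_dom i p -> chart_inv i (chart i p) = p ;
  chart_continuous : forall i p, chart_dom i p ->
    {for p, continuous (chart i)} ;
  chart_inv_continuous : forall i x, (chart i @` chart_dom i) x ->
    {for x, continuous (chart_inv i)} ;
  transition_smooth : forall i j k,
    smooth_on (chart i @` (chart_dom i `&` chart_dom j))
      (fun x => chart j (chart_inv i x) 0 k)
}.

Section Manifold.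
Variables (R : realType) (m : nat) (M : smooth_manifold R m).
Local Notation idx := (chart_idx M).
Local Notation rV := 'rV[R]_m.

Definition coord_dom (i : idx) : set rV := chart i @` chart_dom i.

Definition overlap (i j : idx) : set rV :=
  chart i @` (chart_dom i `&` chart_dom j).

Definition transition (i j : idx) (x : rV) : rV := chart j (chart_inv i x).

(** [jac i j x a c] is dy^c/dx^a, for [x] the coordinates of chart [i] and [y]
    those of chart [j]. *)
Definition jac (i j : idx) (x : rV) (a c : 'I_m) : R :=
  pderiv a (fun z => transition i j z 0 c) x.

(** Tensors at a point and tensor fields are handled through their components
    in the coordinate frames of the charts: [T i x a b] is the value at the
    point of coordinates [x] in chart [i] of the tensor on the coordinate
    vectors number [a] and [b]. *)
Record cov2_tensor := Cov2Tensor {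
  comp2 :> idx -> rV -> 'M[R]_m ;
  comp2_smooth : forall i a b,
    smooth_on (coord_dom i) (fun x => comp2 i x a b) ;
  comp2_change : forall i j x, overlap i j x -> forall a b,
    comp2 i x a b =
      \sum_c \sum_d jac i j x a c * jac i j x b d
                    * comp2 j (transition i j x) c d
}.

Record symplectic_form := SymplecticForm {
  form2 :> cov2_tensor ;
  form2_skew : forall i x, coord_dom i x -> forall a b,
    form2 i x a b = - form2 i x b a ;
  form2_nondegenerate : forall i x, coord_dom i x -> form2 i x \in unitmx ;
  form2_closed : forall i x, coord_dom i x -> forall a b c,
    pderiv a (fun z => form2 i z b c) x + pderiv b (fun z => form2 i z c a) x
      + pderiv c (fun z => form2 i z a b) x = 0
}.

(** [christoffel i x a b k] is the [k]-th component of the covariant derivative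
    of the [b]-th coordinate vector field of chart [i] in the direction of the
    [a]-th one. *)
Record affine_connection := AffineConnection {
  christoffel : idx -> rV -> 'I_m -> 'I_m -> 'I_m -> R ;
  christoffel_smooth : forall i a b k,
    smooth_on (coord_dom i) (fun x => christoffel i x a b k) ;
  christoffel_change : forall i j x, overlap i j x -> forall a b l,
    \sum_k christoffel i x a b k * jac i j x k l =
      pderiv a (fun z => jac i j z b l) x
      + \sum_c \sum_d jac i j x a c * jac i j x b d
                      * christoffel j (transition i j x) c d l
}.

Definition dirderiv (X : rV -> rV) (f : rV -> R) (x : rV) : R :=
  \sum_a X x 0 a * pderiv a f x.

Definition lie_bracket (X Y : rV -> rV) (x : rV) : rV :=
  \row_k (dirderiv X (fun z => Y z 0 k) x - dirderiv Y (fun z => X z 0 k) x).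

Definition coord_field (a : 'I_m) : rV -> rV := fun=> delta_mx 0 a.

Variable nabla : affine_connection.
Local Notation Gamma := (christoffel nabla).

Definition cov (i : idx) (X Y : rV -> rV) (x : rV) : rV :=
  \row_k (dirderiv X (fun z => Y z 0 k) x
          + \sum_a \sum_b Gamma i x a b k * X x 0 a * Y x 0 b).

Definition torsion (i : idx) (X Y : rV -> rV) (x : rV) : rV :=
  cov i X Y x - cov i Y X x - lie_bracket X Y x.

Definition curvature (i : idx) (X Y Z : rV -> rV) (x : rV) : rV :=
  cov i X (cov i Y Z) x - cov i Y (cov i X Z) x - cov i (lie_bracket X Y) Z x.

Definition torsion_free : Prop :=
  forall i x, coord_dom i x -> forall a b,
    torsion i (coord_field a) (coord_field b) x = 0.

(** R_{abc}^d *)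
Definition Rm (i : idx) (x : rV) (a b c d : 'I_m) : R :=
  curvature i (coord_field a) (coord_field b) (coord_field c) x 0 d.

(** R(X,Y)Z for tangent vectors X, Y, Z at a point *)
Definition Rm_at (i : idx) (x X Y Z : rV) : rV :=
  \row_d \sum_a \sum_b \sum_c X 0 a * Y 0 b * Z 0 c * Rm i x a b c d.

Definition ricci (i : idx) (x : rV) : 'M[R]_m :=
  \matrix_(a, b) \sum_p Rm i x p a b p.

(** nabla_e T_{ab} *)
Definition cov_deriv2 (T : idx -> rV -> 'M[R]_m) (i : idx) (x : rV)
    (e a b : 'I_m) : R :=
  pderiv e (fun z => T i z a b) x
  - \sum_p Gamma i x e a p * T i x p b
  - \sum_p Gamma i x e b p * T i x a p.

Definition parallel2 (T : idx -> rV -> 'M[R]_m) : Prop :=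
  forall i x, coord_dom i x -> forall e a b, cov_deriv2 T i x e a b = 0.

(** nabla_e R_{abc}^d *)
Definition cov_deriv_Rm (i : idx) (x : rV) (e a b c d : 'I_m) : R :=
  pderiv e (fun z => Rm i z a b c d) x
  - \sum_p Gamma i x e a p * Rm i x p b c d
  - \sum_p Gamma i x e b p * Rm i x a p c d
  - \sum_p Gamma i x e c p * Rm i x a b p d
  + \sum_p Gamma i x e p d * Rm i x a b c p.

Definition locally_symmetric : Prop :=
  forall i x, coord_dom i x -> forall e a b c d,
    cov_deriv_Rm i x e a b c d = 0.

Definition bilin (T : idx -> rV -> 'M[R]_m) (i : idx) (x X Y : rV) : R :=
  \sum_a \sum_b X 0 a * T i x a b * Y 0 b.

Variable Omega : symplectic_form.

Definition symplectic_connection : Prop := torsion_free /\ parallel2 Omega.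

Definition symplectic_plane (i : idx) (x : rV) (L : {vspace rV}) : Prop :=
  \dim L = 2 /\
  forall X, X \in L -> (forall Y, Y \in L -> bilin Omega i x X Y = 0) -> X = 0.

(** The quadratic form K_{p,L}, computed from one basis of the plane [L]; see
    [plane_curvatureE] for the independence from that basis. *)
Definition plane_curvature (i : idx) (x : rV) (L : {vspace rV}) (Z : rV) : R :=
  let X := (vbasis L)`_0 in
  let Y := (vbasis L)`_1 in
  bilin Omega i x (Rm_at i x X Y Z) Z / bilin Omega i x X Y.

Definition constant_symplectic_sectional_curvature : Prop :=
  exists A : cov2_tensor,
    [/\ forall i x, coord_dom i x -> forall a b, A i x a b = A i x b a,
        parallel2 A &
        forall i x, coord_dom i x ->
        forall L : {vspace rV}, symplectic_plane i x L ->
        forall Z, Z \in L -> plane_curvature i x L Z = bilin A i x Z Z].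

(** R_{abcd} *)
Definition Rm_low (i : idx) (x : rV) (a b c d : 'I_m) : R :=
  \sum_p Rm i x a b c p * Omega i x p d.

End Manifold.

(** W_{abcd}, in dimension 2n *)
Definition symplectic_weyl (R : realType) (n : nat)
    (M : smooth_manifold R (2 * n)) (nabla : affine_connection M)
    (Omega : symplectic_form M) (i : chart_idx M) (x : 'rV[R]_(2 * n))
    (a b c d : 'I_(2 * n)) : R :=
  let Om := Omega i x in
  let Ric := ricci nabla i x in
  Rm_low nabla Omega i x a b c d
  - (n.+1%:R)^-1 *
    (2^-1 * (Om a c * Ric d b + Om a d * Ric c b)
     - 2^-1 * (Om b c * Ric d a + Om b d * Ric c a)
     + Om a b * Ric c d).

Definition weyl_flat (R : realType) (n : nat)
    (M : smooth_manifold R (2 * n)) (nabla : affine_connection M)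
    (Omega : symplectic_form M) : Prop :=
  forall i x, coord_dom i x -> forall a b c d,
    symplectic_weyl nabla Omega i x a b c d = 0.

Section BasisIndependence.
Variables (R : realType) (m : nat) (M : smooth_manifold R m).
Variables (nabla : affine_connection M) (Omega : symplectic_form M).
Local Notation rV := 'rV[R]_m.
Implicit Types (i : chart_idx M) (x X Y Z : rV).

Lemma Rm_skew i x a b c d : Rm nabla i x b a c d = - Rm nabla i x a b c d.
Proof.
have bN (U V : rV -> rV) z k :
    lie_bracket V U z 0 k = - lie_bracket U V z 0 k.
  by rewrite !mxE opprB.
have cN (U V W : rV -> rV) z k : (forall k, U z 0 k = - V z 0 k) ->
    cov nabla i U W z 0 k = - cov nabla i V W z 0 k.
  move=> UV; rewrite !mxE opprD; congr (_ + _).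
    by rewrite /dirderiv -sumrN; apply: eq_bigr => e _; rewrite UV mulNr.
  rewrite -sumrN; apply: eq_bigr => e _; rewrite -sumrN.
  by apply: eq_bigr => f _; rewrite UV mulrN mulNr.
have sE (U V : rV) k : (U - V) 0 k = U 0 k - V 0 k by rewrite !mxE.
rewrite /Rm /curvature !sE.
by rewrite (cN _ _ _ _ _ (bN (coord_field a) (coord_field b) x)); ring.
Qed.

Lemma bilinDl (T : chart_idx M -> rV -> 'M[R]_m) i x (s t : R) X Y Z :
  bilin T i x (s *: X + t *: Y) Z = s * bilin T i x X Z + t * bilin T i x Y Z.
Proof.
rewrite /bilin !big_distrr /= -big_split; apply: eq_bigr => a _ /=.
rewrite !big_distrr /= -big_split; apply: eq_bigr => b _ /=.
by rewrite !mxE; ring.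
Qed.

Lemma bilinDr (T : chart_idx M -> rV -> 'M[R]_m) i x (s t : R) X Y Z :
  bilin T i x Z (s *: X + t *: Y) = s * bilin T i x Z X + t * bilin T i x Z Y.
Proof.
rewrite /bilin !big_distrr /= -big_split; apply: eq_bigr => a _ /=.
rewrite !big_distrr /= -big_split; apply: eq_bigr => b _ /=.
by rewrite !mxE; ring.
Qed.

Lemma bilin_skew i x X Y : coord_dom i x ->
  bilin Omega i x Y X = - bilin Omega i x X Y.
Proof.
move=> ix; rewrite /bilin exchange_big -sumrN; apply: eq_bigr => a _ /=.
rewrite -sumrN; apply: eq_bigr => b _.
by rewrite (form2_skew Omega ix); ring.
Qed.

Lemma Rm_at_skew i x X Y Z : Rm_at nabla i x Y X Z = - Rm_at nabla i x X Y Z.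
Proof.
apply/rowP => d; rewrite !mxE exchange_big -sumrN; apply: eq_bigr => a _ /=.
rewrite -sumrN; apply: eq_bigr => b _; rewrite -sumrN; apply: eq_bigr => c _.
by rewrite Rm_skew; ring.
Qed.

Lemma Rm_atDl i x (s t : R) X X' Y Z :
  Rm_at nabla i x (s *: X + t *: X') Y Z =
  s *: Rm_at nabla i x X Y Z + t *: Rm_at nabla i x X' Y Z.
Proof.
apply/rowP => d; rewrite !mxE !big_distrr /= -big_split; apply: eq_bigr => a _ /=.
rewrite !big_distrr /= -big_split; apply: eq_bigr => b _ /=.
rewrite !big_distrr /= -big_split; apply: eq_bigr => c _ /=.
by rewrite !mxE; ring.
Qed.

Lemma Rm_atDr i x (s t : R) X Y Y' Z :
  Rm_at nabla i x X (s *: Y + t *: Y') Z =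
  s *: Rm_at nabla i x X Y Z + t *: Rm_at nabla i x X Y' Z.
Proof.
by rewrite Rm_at_skew Rm_atDl opprD -!scalerN -!Rm_at_skew.
Qed.

Lemma plane_curvatureE i x (L : {vspace rV}) X Y Z :
  coord_dom i x -> symplectic_plane Omega i x L -> basis_of L [:: X; Y] ->
  plane_curvature nabla Omega i x L Z =
  bilin Omega i x (Rm_at nabla i x X Y Z) Z / bilin Omega i x X Y.
Proof.
move=> ix [dimL _] /andP[/eqP spanXY freeXY].
have := vbasisP L; rewrite /plane_curvature; move: (vbasis L).
rewrite dimL => -[[|X' [|Y' []]] //= _] /andP[/eqP spanXY' freeXY'].
have inL U : U \in [:: X'; Y'] -> exists s t, U = s *: X + t *: Y.
  move=> /memv_span; rewrite spanXY' -spanXY span_cons span_seq1.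
  by case/memv_addP => _ /vlineP[s ->] [_ /vlineP[t ->] ->]; exists s, t.
have [a [b EX]] : exists s t, X' = s *: X + t *: Y by apply: inL; rewrite !inE eqxx.
have [c [d EY]] : exists s t, Y' = s *: X + t *: Y.
  by apply: inL; rewrite !inE eqxx orbT.
have det_neq0 : a * d - b * c != 0.
  apply/eqP => det0.
  have /freeP free2 : free (in_tuple [:: X'; Y']) by [].
  have rel (s t : R) : s *: X' + t *: Y' = 0 -> s = 0 /\ t = 0.
    move=> st0; have := free2 (fun k => if k == 0 :> nat then s else t).
    rewrite big_ord_recl big_ord1 /= => /(_ st0) H.
    by split; [have := H ord0 | have := H (lift ord0 ord0)].
  have comb (s t : R) : s *: X' + t *: Y' =
      (s * a + t * c) *: X + (s * b + t * d) *: Y.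
    rewrite EX EY !scalerDr !scalerA addrACA -!scalerDl.
    by [].
  have [d0 b0] : d = 0 /\ - b = 0.
    apply: rel; rewrite comb.
    have -> : d * a + - b * c = a * d - b * c by ring.
    have -> : d * b + - b * d = 0 by ring.
    by rewrite det0 !scale0r addr0.
  have [c0 a0] : - c = 0 /\ a = 0.
    apply: rel; rewrite comb.
    have -> : - c * a + a * c = 0 by ring.
    have -> : - c * b + a * d = a * d - b * c by ring.
    by rewrite det0 !scale0r addr0.
  have X'0 : X' = 0.
    by move/eqP: b0; rewrite oppr_eq0 EX a0 => /eqP ->; rewrite !scale0r addr0.
  have [/eqP] := rel 1 0 ltac:(by rewrite X'0 scaler0 scale0r addr0).
  by rewrite oner_eq0.
have R0 U : Rm_at nabla i x U U Z = 0.
  apply/rowP => k; have /rowP/(_ k) := Rm_at_skew i x U U Z; rewrite !mxE.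
  by move/eqP; rewrite -subr_eq0 opprK -mulr2n mulrn_eq0 /= => /eqP.
have O0 U : bilin Omega i x U U = 0.
  have /eqP := bilin_skew U U ix.
  by rewrite -subr_eq0 opprK -mulr2n mulrn_eq0 /= => /eqP.
have RE : Rm_at nabla i x X' Y' Z = (a * d - b * c) *: Rm_at nabla i x X Y Z.
  rewrite EX Rm_atDl EY !Rm_atDr !R0 !scaler0 add0r addr0 (Rm_at_skew i x X Y).
  by rewrite scalerN scalerN !scalerA -scalerBl.
have OE : bilin Omega i x X' Y' = (a * d - b * c) * bilin Omega i x X Y.
  by rewrite EX bilinDl EY !bilinDr !O0 (bilin_skew X Y ix); ring.
rewrite RE OE -[X in bilin _ _ _ X]addr0 -[0](scale0r 0) bilinDl mul0r addr0.
by rewrite -mulf_div divff ?mul1r.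
Qed.

End BasisIndependence.

(* Main.v *)
From HB Require Import structures.
From mathcomp Require Import all_boot all_order all_algebra.
From mathcomp Require Import all_classical all_reals all_analysis.
From mathcomp Require Import ring lra.
Require Import Defs.

Set Implicit Arguments.
Unset Strict Implicit.
Unset Printing Implicit Defensive.

Import Order.TTheory GRing.Theory Num.Theory.
Import numFieldNormedType.Exports.

(** Write R for the curvature with its last index lowered by the symplectic form
    Omega. It is skew in its first two arguments, satisfies the first Bianchi
    identity because the connection is torsion-free, and is symmetric in its last
    two arguments because Omega is parallel ([Rm_low_sym], an instance of
    [parallel2_ricci_identity]). A tensor B with these symmetries vanishes as soon
    as B(X, Y, X, X) = 0 for all X and Y ([curvature_like_eq0]).

    For a symmetric form S let T(S) = [model_curv] be the tensor occurring in the
    definition of the symplectic Weyl tensor. It has the same symmetries, its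
    sectional curvature on any symplectic plane is 2 S(Z, Z), and its Ricci
    contraction is (n + 1) S ([model_curv_trace]).

    If the sectional curvatures are given by a parallel form A, then R and
    (1/2) T(A) agree on all arguments (X, Y, X, X), so R = (1/2) T(A)
    ([Rm_low_of_constant]). Contracting, the Ricci tensor is (n + 1)/2 times A.
    Hence it is parallel and R = 1/(n + 1) T(Ric), which is Weyl flatness.
    Conversely, if R = 1/(n + 1) T(Ric) then the sectional curvatures are given by
    2/(n + 1) Ric ([sectional_of_model]). In either case R is a polynomial in the
    parallel tensors Omega and Ric, hence parallel, and raising the index back
    shows that the curvature is parallel ([locally_symmetric_of_model]).

    The converse requires the Ricci tensor to be a tensor field, that is, to obey
    the change of coordinates rule ([ricci_change]). This is obtained by viewing
    the Christoffel symbols as a matrix of one-forms: the change of chart is a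
    gauge transformation by the Jacobian composed with a pullback, and the
    curvature form is conjugated by the first ([curv_form_gauge]) and natural
    under the second ([curv_form_pullback]). Both facts, like the Ricci
    identity, rest on the symmetry of second derivatives ([derive_comm]), which
    follows from the mean value theorem. *)

Local Open Scope classical_set_scope.
Local Open Scope ring_scope.

(** * Smooth functions on an open set *)

Section NearDifferentiable.
Variables (K : numFieldType) (V W : normedModType K).
Implicit Types (f g : V -> W) (x : V).

Lemma differentiable_near0 f x :
  (\forall y \near x, f y = 0) -> differentiable f x.
Proof.
move=> f0.
have fx0 : f x = 0 by exact: nbhs_singleton f0.
pose z : {linear V -> W} := (\0 : {linear V -> W}).
have zc : continuous z.
  by have -> : (z : V -> W) = cst 0 by []; exact: cst_continuous.
have fo : f \o shift x = cst (f x) + z +o_ 0 id.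
  apply/eqaddoP => _/posnumP[e].
  have := f0; rewrite (near_shift 0) subr0 => f0'.
  near=> y.
  have fy0 : f (y + x) = 0 by near: y; exact: f0'.
  rewrite !fctE /= fy0 fx0 addr0 subr0 normr0.
  by rewrite mulr_ge0.
apply/diff_locallyP; have -> := diff_unique zc fo.
by [].
Unshelve. all: by end_near. Qed.

Lemma near_eq_differentiable f g x : (\forall y \near x, f y = g y) ->
  differentiable f x -> differentiable g x.
Proof.
move=> fg df; have -> : g = f + (g - f) by rewrite addrC subrK.
apply: differentiableD => //; apply: differentiable_near0.
by near do rewrite !fctE (near fg) ?subrr//.
Unshelve. all: by end_near. Qed.

End NearDifferentiable.

Section Calculus.
Variables (R : realType) (m : nat).
Local Notation rV := 'rV[R]_m.
Implicit Types (D : set rV) (f g : rV -> R) (x : rV) (a b : 'I_m).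

Lemma pderiv_ext D f g a x : open D -> {in D, f =1 g} -> D x ->
  pderiv a f x = pderiv a g x.
Proof.
move=> oD fg Dx; apply: near_eq_derive.
by have := open_nbhs_nbhs (conj oD Dx); apply: filterS => y Dy; apply/fg/mem_set.
Qed.

Lemma iter_pderiv_ext D f g s x : open D -> {in D, f =1 g} -> D x ->
  foldr (@pderiv R m) f s x = foldr (@pderiv R m) g s x.
Proof.
move=> oD fg; elim: s x => [|a s IH] x Dx /=; first exact/fg/mem_set.
by apply: (pderiv_ext a oD) Dx => y /set_mem; exact: IH.
Qed.

Lemma smooth_on_ext D f g : open D -> {in D, f =1 g} ->
  smooth_on D f -> smooth_on D g.
Proof.
move=> oD fg sf s x Dx; apply: near_eq_differentiable (sf s x Dx).
have := open_nbhs_nbhs (conj oD Dx); apply: filterS => y Dy.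
exact: (iter_pderiv_ext s oD fg).
Qed.

Lemma smooth_on_differentiable D f x : smooth_on D f -> D x ->
  differentiable f x.
Proof. by move=> sf; exact: (sf [::]). Qed.

Lemma smooth_on_pderiv D f a : smooth_on D f -> smooth_on D (pderiv a f).
Proof. by move=> sf s x Dx; have := sf (rcons s a) x Dx; rewrite foldr_rcons. Qed.

Lemma pderivD f g a x : differentiable f x -> differentiable g x ->
  pderiv a (fun y => f y + g y) x = pderiv a f x + pderiv a g x.
Proof. by move=> df dg; apply: deriveD; exact: diff_derivable. Qed.

Lemma pderivM f g a x : differentiable f x -> differentiable g x ->
  pderiv a (fun y => f y * g y) x = pderiv a f x * g x + f x * pderiv a g x.
Proof.
move=> df dg; rewrite [LHS]deriveM; try exact: diff_derivable.
by rewrite addrC /GRing.scale /= mulrC.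
Qed.

Lemma pderiv_cst (c : R) a x : pderiv a (fun=> c) x = 0.
Proof. exact: derive_cst. Qed.

Lemma pderivN f a x : differentiable f x ->
  pderiv a (fun y => - f y) x = - pderiv a f x.
Proof. by move=> df; apply: deriveN; exact: diff_derivable. Qed.

Lemma pderivZ (c : R) f a x : differentiable f x ->
  pderiv a (fun y => c * f y) x = c * pderiv a f x.
Proof. by move=> df; apply: deriveZ; exact: diff_derivable. Qed.

Lemma pderiv_sum n (F : 'I_n -> rV -> R) a x :
  (forall k, differentiable (F k) x) ->
  pderiv a (fun y => \sum_k F k y) x = \sum_k pderiv a (F k) x.
Proof.
move=> dF; rewrite /pderiv -derive_sum => [|k]; last exact: diff_derivable.
by congr ('D_ _ _ _); apply/funext => y; rewrite fct_sumE.
Qed.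

Lemma smooth_on_cst D (c : R) : smooth_on D (fun=> c).
Proof.
move=> s x _; suff [d ->] : exists d : R, foldr (@pderiv R m) (fun=> c) s = fun=> d.
  exact: differentiable_cst.
elim: s => [|a s [d IH]] /=; first by exists c.
by exists 0; apply/funext => y; rewrite IH pderiv_cst.
Qed.

(** Closing the smooth functions under sums and products yields a class that is
    visibly stable under partial derivatives, by the Leibniz rule; this avoids
    expanding the iterated derivatives of a product. *)
Inductive smooth_algebra D : (rV -> R) -> Prop :=
| smooth_gen f : smooth_on D f -> smooth_algebra D f
| smooth_add f g : smooth_algebra D f -> smooth_algebra D g ->
    smooth_algebra D (fun x => f x + g x)
| smooth_mul f g : smooth_algebra D f -> smooth_algebra D g ->
    smooth_algebra D (fun x => f x * g x)
| smooth_eq f g : {in D, f =1 g} -> smooth_algebra D f -> smooth_algebra D g.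

Lemma smooth_algebra_differentiable D f x : open D -> smooth_algebra D f ->
  D x -> differentiable f x.
Proof.
move=> oD; elim=> {f} [f sf|f g _ df _ dg|f g _ df _ dg|f g fg _ df] Dx.
- exact: smooth_on_differentiable Dx.
- by apply: differentiableD; [exact: df|exact: dg].
- by apply: differentiableM; [exact: df|exact: dg].
apply: near_eq_differentiable (df Dx).
by have := open_nbhs_nbhs (conj oD Dx); apply: filterS => y Dy; apply/fg/mem_set.
Qed.

Lemma smooth_algebra_pderiv D f a : open D -> smooth_algebra D f ->
  smooth_algebra D (pderiv a f).
Proof.
move=> oD; have df := smooth_algebra_differentiable oD.
elim=> {f} [f sf|f g sf sf' sg sg'|f g sf sf' sg sg'|f g fg sf sf'].
- exact/smooth_gen/smooth_on_pderiv.
- apply: smooth_eq (smooth_add sf' sg') => x /set_mem Dx.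
  by rewrite pderivD//; apply: df Dx.
- apply: smooth_eq (smooth_add (smooth_mul sf' sg) (smooth_mul sf sg')).
  by move=> x /set_mem Dx; rewrite pderivM//; apply: df Dx.
apply: smooth_eq sf' => x /set_mem Dx; exact: (pderiv_ext a oD fg).
Qed.

Lemma smooth_algebraW D f : open D -> smooth_algebra D f -> smooth_on D f.
Proof.
move=> oD sf s; elim/last_ind: s f sf => [|s a IH] f sf x Dx.
  exact: smooth_algebra_differentiable Dx.
by rewrite foldr_rcons; apply: IH => //; exact: smooth_algebra_pderiv.
Qed.

Lemma smooth_onD D f g : open D -> smooth_on D f -> smooth_on D g ->
  smooth_on D (fun x => f x + g x).
Proof.
by move=> oD sf sg; apply/smooth_algebraW/smooth_add => //; exact: smooth_gen.
Qed.

Lemma smooth_onM D f g : open D -> smooth_on D f -> smooth_on D g ->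
  smooth_on D (fun x => f x * g x).
Proof.
by move=> oD sf sg; apply/smooth_algebraW/smooth_mul => //; exact: smooth_gen.
Qed.

Lemma smooth_onZ D (c : R) f : open D -> smooth_on D f ->
  smooth_on D (fun x => c * f x).
Proof. by move=> oD sf; apply: smooth_onM => //; exact: smooth_on_cst. Qed.

Lemma smooth_onB D f g : open D -> smooth_on D f -> smooth_on D g ->
  smooth_on D (fun x => f x - g x).
Proof.
move=> oD sf sg; apply: smooth_onD => //.
apply: smooth_on_ext (smooth_onZ (-1) oD sg) => // x _.
by rewrite mulN1r.
Qed.

Lemma smooth_on_sum D n (F : 'I_n -> rV -> R) : open D ->
  (forall k, smooth_on D (F k)) -> smooth_on D (fun x => \sum_k F k x).
Proof.
move=> oD; elim: n F => [|n IH] F sF.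
  apply: smooth_on_ext (@smooth_on_cst D 0) => // x _; by rewrite big_ord0.
apply: smooth_on_ext (smooth_onD oD (sF ord0) (IH _ (fun k => sF (lift ord0 k)))) => //.
by move=> x _; rewrite big_ord_recl.
Qed.

End Calculus.

(** * Symmetry of second derivatives *)

Section Schwarz.
Variables (R : realType) (V : normedModType R).
Implicit Types (f : V -> R) (x y u v : V).

Lemma is_derive_line f y v (s : R) : differentiable f (s *: v + y) ->
  is_derive s 1 (fun h : R => f (h *: v + y)) ('D_v f (s *: v + y)).
Proof.
move=> df; have dl : is_diff s (fun h : R => h *: v + y) (fun h => h *: v + 0).
  exact: is_diffD.
have df' := differentiableP df.
have dc := is_diff_comp dl df'.
apply: DeriveDef; first exact/diff_derivable/ex_diff.
rewrite deriveE; last exact/ex_diff.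
have -> : 'd (fun h : R => f (h *: v + y)) s 1 = 'd f (s *: v + y) (1 *: v + 0).
  by have /= := congr1 (fun g : R -> R => g 1) (@diff_val _ _ _ _ _ _ _ dc).
by rewrite addr0 scale1r deriveE.
Qed.

Lemma MVT_line f y v (h : R) : 0 < h ->
  (forall s, s \in `[0, h] -> differentiable f (s *: v + y)) ->
  exists2 s, s \in `]0, h[ & f (h *: v + y) - f y = h * 'D_v f (s *: v + y).
Proof.
move=> h0 df.
pose g (s : R) : R := f (s *: v + y).
have dg s : s \in `[0, h] -> is_derive s 1 g ('D_v f (s *: v + y)).
  by move=> /df; exact: is_derive_line.
have cg : {within `[0, h], continuous g}.
  by apply: derivable_within_continuous => s /dg /@ex_derive.
pose dd (s : R) : R := 'D_v f (s *: v + y).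
have dg' s : s \in `]0, h[%R -> is_derive s 1 g (dd s).
  by move=> /subset_itv_oo_cc /dg.
have [s sh E] := MVT h0 dg' cg.
by exists s => //; move: E; rewrite /g scale0r add0r subr0 mulrC.
Qed.

(** The second difference quotient of [f] is symmetric in the two directions,
    and applying the mean value theorem once in each direction turns it into a
    mixed second derivative at a nearby point. *)
Lemma second_difference f x u v (h : R) : 0 < h ->
  (forall s t, s \in `[0, h] -> t \in `[0, h] ->
    differentiable f (s *: u + t *: v + x) /\
    differentiable ('D_u f) (s *: u + t *: v + x)) ->
  exists s t, [/\ s \in `]0, h[, t \in `]0, h[ &
    f (h *: u + h *: v + x) - f (h *: u + x) - f (h *: v + x) + f x =
    h * (h * 'D_v ('D_u f) (s *: u + t *: v + x))].
Proof.
move=> h0 df.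
have h0h : 0 \in `[0, h] by rewrite in_itv /= lexx ltW.
have hh : h \in `[0, h] by rewrite in_itv /= lexx ltW.
have dsh y : differentiable (fun z : V => z + h *: v) y.
  by apply: differentiableD.
have dF1 s : s \in `[0, h] -> differentiable (fun z => f (z + h *: v)) (s *: u + x).
  move=> sh; apply: differentiable_comp => //.
  by rewrite addrAC; exact: (df _ _ sh hh).1.
have dF2 s : s \in `[0, h] -> differentiable f (s *: u + x).
  by move=> sh; have := (df _ _ sh h0h).1; rewrite scale0r addr0.
have [|s sh E1] := @MVT_line ((fun z => f (z + h *: v)) - f) x u h h0.
  by move=> s sh; apply: differentiableB; [exact: dF1|exact: dF2].
have sh' := subset_itv_oo_cc sh.
have [|t th E2] := @MVT_line ('D_u f) (s *: u + x) v h h0.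
  by move=> t th; rewrite addrCA addrA; exact: (df _ _ sh' th).2.
exists s, t; split => //.
have -> : s *: u + t *: v + x = t *: v + (s *: u + x) by rewrite addrCA addrA.
rewrite -E2.
have -> : 'D_u f (h *: v + (s *: u + x)) =
    'D_u (fun z => f (z + h *: v)) (s *: u + x).
  rewrite /derive; set F := (F in lim (F @ _) = _); set G := (G in _ = lim (G @ _)).
  suff -> : F = G by []; apply/funext => k; rewrite /F /G /=.
  by rewrite (addrC (h *: v)) addrA.
rewrite -deriveB; try exact/diff_derivable/dF1; try exact/diff_derivable/dF2.
  by rewrite -E1 !fctE (addrAC (h *: u)) (addrC (h *: v) x); ring.
Qed.

(** Both mixed derivatives at [x] are limits of the same second difference
    quotient, taken along steps that shrink to zero. *)
Theorem derive_comm f x u v :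
  (\forall y \near x, [/\ differentiable f y, differentiable ('D_u f) y &
     differentiable ('D_v f) y]) ->
  {for x, continuous ('D_v ('D_u f))} -> {for x, continuous ('D_u ('D_v f))} ->
  'D_v ('D_u f) x = 'D_u ('D_v f) x.
Proof.
move=> df /cvgrPdist_lt cp /cvgrPdist_lt cq.
apply/eqP; rewrite -subr_eq0 -normr_le0; apply/ler_addgt0Pl => e e0.
rewrite addr0; have e20 : 0 < e / 2 by rewrite divr_gt0.
have N := filterI df (filterI (cp _ e20) (cq _ e20)).
have [r /= r0 near_x] := (nbhs_ballP _ _).1 (N _ _).
(* The step keeps the whole parallelogram spanned by h u and h v in the ball. *)
pose h := r / (`|u| + `|v| + 1).
have N0 : 0 < `|u| + `|v| + 1 by rewrite ltr_wpDl// addr_ge0.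
have h0 : 0 < h by rewrite divr_gt0.
have inball s t : s \in `[0, h] -> t \in `[0, h] -> ball x r (s *: u + t *: v + x).
  rewrite !in_itv /= => /andP[s0 sh] /andP[t0 th].
  rewrite -ball_normE /ball_ /= opprD addrCA subrr addr0 normrN.
  apply: (le_lt_trans (ler_normD _ _)); rewrite !normrZ !ger0_norm//.
  apply: (@le_lt_trans _ _ (h * (`|u| + `|v|))).
    by rewrite mulrDr lerD// ler_wpM2r.
  by rewrite /h -mulrA gtr_pMr// mulrC ltr_pdivrMr// mul1r ltrDl.
have [|s [t [sh th E]]] := @second_difference f x u v h h0.
  by move=> s t sh th; have [[]] := near_x _ (inball _ _ sh th).
have [|t' [s' [t'h s'h E']]] := @second_difference f x v u h h0.
  move=> t' s' t'h s'h; have [[]] := near_x _ (inball _ _ s'h t'h).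
  by rewrite (addrC (s' *: u)).
have := near_x _ (inball _ _ (subset_itv_oo_cc sh) (subset_itv_oo_cc th)).
move=> [_ [/= dp _]].
have := near_x _ (inball _ _ (subset_itv_oo_cc s'h) (subset_itv_oo_cc t'h)).
move=> [_ [_ /= dq]].
have pq : 'D_v ('D_u f) (s *: u + t *: v + x) = 'D_u ('D_v f) (s' *: u + t' *: v + x).
  apply: (mulfI (lt0r_neq0 h0)); apply: (mulfI (lt0r_neq0 h0)).
  have -> : s' *: u + t' *: v + x = t' *: v + s' *: u + x.
    by congr (_ + _); exact: addrC.
  apply: etrans (esym E) (etrans _ E').
  have -> : h *: v + h *: u = h *: u + h *: v by exact: addrC.
  by congr (_ + _); rewrite addrAC.
rewrite -pq in dq.
rewrite -(subrKA ('D_v ('D_u f) (s *: u + t *: v + x))).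
apply: le_trans (ler_normD _ _) _; rewrite [leRHS]splitr.
by apply: lerD; apply: ltW; [exact: dp|rewrite distrC; exact: dq].
Qed.

End Schwarz.

(** * Chain rule, matrix-valued functions and connection forms *)

Lemma differentiable_row (R : realType) (V : normedModType R) n (y : V -> 'rV[R]_n) x :
  (forall k, differentiable (fun z => y z 0 k) x) -> differentiable y x.
Proof.
move=> dyk.
have -> : y = \sum_k (fun z => y z 0 k *: delta_mx 0 k).
  by apply/funext => z; rewrite fct_sumE [LHS]row_sum_delta.
by apply: differentiable_sum => k; exact: differentiableZl.
Qed.

Section ChainRule.
Variables (R : realType) (m n : nat).

Lemma pderiv_comp (f : 'rV[R]_n -> R) (y : 'rV[R]_m -> 'rV[R]_n) x a :
  differentiable f (y x) ->
  (forall k, differentiable (fun z => y z 0 k) x) ->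
  pderiv a (fun z => f (y z)) x =
  \sum_k pderiv a (fun z => y z 0 k) x * pderiv k f (y x).
Proof.
move=> df dyk.
have dy : differentiable y x by exact: differentiable_row.
have dfy : differentiable (f \o y) x by exact: differentiable_comp.
have dyE : 'd y x (delta_mx 0 a) =
    \sum_k pderiv a (fun z => y z 0 k) x *: delta_mx 0 k.
  rewrite -deriveE// derive_mx; last exact: diff_derivable.
  by rewrite [LHS]row_sum_delta; apply: eq_bigr => k _; rewrite mxE.
rewrite /pderiv [LHS](deriveE _ dfy) diff_comp//= dyE linear_sum.
by apply: eq_bigr => k _; rewrite linearZ /= -deriveE.
Qed.

End ChainRule.

(** Locked, because comparing two partial derivatives by unfolding them down to
    limits is hopeless. *)
HB.lock Definition mderiv (R : realType) (m p q : nat) (a : 'I_m)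
    (F : 'rV[R]_m -> 'M[R]_(p, q)) (x : 'rV[R]_m) : 'M[R]_(p, q) :=
  \matrix_(i, j) pderiv a (fun z => F z i j) x.

Section MatrixCalculus.
Variables (R : realType) (m : nat).
Local Notation rV := 'rV[R]_m.

Lemma mderivE p q a (F : rV -> 'M[R]_(p, q)) x i j :
  mderiv a F x i j = pderiv a (fun z => F z i j) x.
Proof. by rewrite mderiv.unlock mxE. Qed.

Definition mdifferentiable p q (F : rV -> 'M[R]_(p, q)) (x : rV) : Prop :=
  forall i j, differentiable (fun z => F z i j) x.

Implicit Types (D : set rV) (x : rV) (a b : 'I_m).

Lemma pderiv_comm D (f : rV -> R) a b x : open D -> smooth_on D f -> D x ->
  pderiv a (pderiv b f) x = pderiv b (pderiv a f) x.
Proof.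
move=> oD sf Dx; apply: derive_comm.
- have := open_nbhs_nbhs (conj oD Dx); apply: filterS => y Dy; split.
  + exact: smooth_on_differentiable Dy.
  + exact: smooth_on_differentiable (smooth_on_pderiv b sf) Dy.
  + exact: smooth_on_differentiable (smooth_on_pderiv a sf) Dy.
- apply/differentiable_continuous/(smooth_on_differentiable _ Dx).
  exact/smooth_on_pderiv/smooth_on_pderiv.
apply/differentiable_continuous/(smooth_on_differentiable _ Dx).
exact/smooth_on_pderiv/smooth_on_pderiv.
Qed.

Lemma mderiv_ext D p q (F G : rV -> 'M[R]_(p, q)) a x : open D ->
  {in D, F =1 G} -> D x -> mderiv a F x = mderiv a G x.
Proof.
move=> oD FG Dx; apply/matrixP => i j; rewrite 2!mderivE.
by apply: (pderiv_ext a oD _ Dx) => z /FG ->.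
Qed.

Lemma mdifferentiableM p q r (F : rV -> 'M[R]_(p, q)) (G : rV -> 'M[R]_(q, r)) x :
  mdifferentiable F x -> mdifferentiable G x ->
  mdifferentiable (fun z => F z *m G z) x.
Proof.
move=> dF dG i j; have -> : (fun z => (F z *m G z) i j) =
    \sum_k (fun z => F z i k * G z k j).
  by apply/funext => z; rewrite fct_sumE mxE.
by apply: differentiable_sum => k; exact: differentiableM.
Qed.

Lemma mderivM p q r (F : rV -> 'M[R]_(p, q)) (G : rV -> 'M[R]_(q, r)) a x :
  mdifferentiable F x -> mdifferentiable G x ->
  mderiv a (fun z => F z *m G z) x = mderiv a F x *m G x + F x *m mderiv a G x.
Proof.
move=> dF dG; apply/matrixP => i j; rewrite mderivE.
have -> : (fun z => (F z *m G z) i j) = (fun z => \sum_k (F z i k * G z k j)).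
  by apply/funext => z; exact: mxE.
rewrite pderiv_sum => [|k]; last exact: differentiableM.
rewrite [RHS]mxE [X in X + _]mxE [X in _ + X]mxE -big_split.
by apply: eq_bigr => k _; rewrite pderivM// 2!mderivE.
Qed.

Lemma mderivD p q (F G : rV -> 'M[R]_(p, q)) a x :
  mdifferentiable F x -> mdifferentiable G x ->
  mderiv a (fun z => F z + G z) x = mderiv a F x + mderiv a G x.
Proof.
move=> dF dG; apply/matrixP => i j; rewrite [RHS]mxE 3!mderivE -pderivD//.
have -> : (fun z => (F z + G z) i j) = fun z => F z i j + G z i j.
  by apply/funext => z; exact: mxE.
by [].
Qed.

Lemma mdifferentiable_tr p q (F : rV -> 'M[R]_(p, q)) x :
  mdifferentiable F x -> mdifferentiable (fun z => (F z)^T) x.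
Proof.
move=> dF i j; have -> : (fun z => (F z)^T i j) = fun z => F z j i.
  by apply/funext => z; rewrite mxE.
exact: dF.
Qed.

Lemma mderiv_tr p q (F : rV -> 'M[R]_(p, q)) a x :
  mderiv a (fun z => (F z)^T) x = (mderiv a F x)^T.
Proof.
apply/matrixP => i j; rewrite [RHS]mxE 2!mderivE.
have -> : (fun z => (F z)^T i j) = fun z => F z j i.
  by apply/funext => z; exact: mxE.
by [].
Qed.

Lemma mderiv_comm D p q (F : rV -> 'M[R]_(p, q)) a b x : open D ->
  (forall i j, smooth_on D (fun z => F z i j)) -> D x ->
  mderiv a (mderiv b F) x = mderiv b (mderiv a F) x.
Proof.
move=> oD sF Dx; have E c i j : (fun z => mderiv c F z i j) = pderiv c (fun z => F z i j).
  by apply/funext => z; exact: mderivE.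
by apply/matrixP => i j; rewrite 2!mderivE 2!E; exact: (pderiv_comm a b oD (sF i j) Dx).
Qed.

(** The curvature of a matrix-valued connection form on two coordinate fields.
    Matrices act on row vectors, which reverses the order of the products. *)
Definition curv_form (th : 'I_m -> rV -> 'M[R]_m) a b x : 'M[R]_m :=
  mderiv a (th b) x - mderiv b (th a) x + th b x *m th a x - th a x *m th b x.

(** Differentiating the gauge equation once more and antisymmetrizing kills the
    second derivatives of the gauge [J], so that the curvature is conjugated. *)
Lemma curv_form_gauge D (th th' : 'I_m -> rV -> 'M[R]_m) (J : rV -> 'M[R]_m)
    a b x : open D -> D x ->
  (forall i j, smooth_on D (fun z => J z i j)) ->
  (forall c, mdifferentiable (th c) x) ->
  (forall c, mdifferentiable (th' c) x) ->
  (forall c z, D z -> th c z *m J z = mderiv c J z + J z *m th' c z) ->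
  curv_form th a b x *m J x = J x *m curv_form th' a b x.
Proof.
move=> oD Dx sJ dth dth' E.
have dJ : mdifferentiable J x.
  by move=> i j; exact: smooth_on_differentiable (sJ i j) Dx.
have ddJ c : mdifferentiable (mderiv c J) x.
  move=> i j; have -> : (fun z => mderiv c J z i j) = pderiv c (fun z => J z i j).
    by apply/funext => z; exact: mderivE.
  exact: smooth_on_differentiable (smooth_on_pderiv c (sJ i j)) Dx.
have dE c d : mderiv c (th d) x *m J x + th d x *m mderiv c J x =
    mderiv c (mderiv d J) x +
    (mderiv c J x *m th' d x + J x *m mderiv c (th' d) x).
  rewrite -!mderivM// -mderivD//; last exact: mdifferentiableM.
  by apply: (mderiv_ext c oD _ Dx) => z /set_mem Dz; rewrite E.
have JE c : mderiv c J x = th c x *m J x - J x *m th' c x.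
  by rewrite E// addrK.
have S := mderiv_comm a b oD sJ Dx.
have E1 := dE a b; have E2 := dE b a; rewrite S in E1.
move: E1 E2; rewrite !JE !mulmxBl !mulmxBr !mulmxA => E1 E2.
have {E1 E2} := congr2 (fun A B => A - B) E1 E2.
rewrite /curv_form !mulmxDl !mulmxDr !mulNmx !mulmxN !mulmxA.
move: (mderiv a (th b) x *m J x) (mderiv b (th a) x *m J x).
move: (mderiv b (mderiv a J) x) (J x *m mderiv a (th' b) x) (J x *m mderiv b (th' a) x).
move: (th b x *m th a x *m J x) (th a x *m th b x *m J x).
move: (th b x *m J x *m th' a x) (th a x *m J x *m th' b x).
move: (J x *m th' a x *m th' b x) (J x *m th' b x *m th' a x).
move=> A1 A2 A3 A4 A5 A6 A7 A8 A9 A10 A11 /matrixP H; apply/matrixP => i j.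
by move: (H i j); rewrite !mxE; lra.
Qed.

End MatrixCalculus.

(** * Curvature in a coordinate chart *)

Lemma coord_dom_open (R : realType) (m : nat) (M : smooth_manifold R m)
  (i : chart_idx M) : open (coord_dom i).
Proof. exact: chart_img_open. Qed.
Arguments coord_dom_open {R m M} i.

Section Domains.
Variables (R : realType) (m : nat) (M : smooth_manifold R m).
Implicit Types (i j : chart_idx M) (x : 'rV[R]_m).

Lemma overlap_coord_dom i j : overlap i j `<=` coord_dom i.
Proof. by move=> _ [p [ip _] <-]; exists p. Qed.

Lemma transition_coord_dom i j x : overlap i j x -> coord_dom j (transition i j x).
Proof. by move=> [p [ip jp] <-]; exists p => //; rewrite /transition chartK. Qed.

Lemma overlap_open i j : open (overlap i j).
Proof.
rewrite openE => x [p [ip jp] <-].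
have ix : (chart i @` chart_dom i) (chart i p) by exists p.
have jN : nbhs (chart_inv i (chart i p)) (chart_dom j).
  by rewrite chartK//; apply: open_nbhs_nbhs; split=> //; exact: chart_dom_open.
have N1 : nbhs (chart i p) [set y | chart_dom j (chart_inv i y)].
  exact: chart_inv_continuous ix _ jN.
have N2 := open_nbhs_nbhs (conj (coord_dom_open i) ix).
have sub : [set y | chart_dom j (chart_inv i y)] `&` coord_dom i `<=` overlap i j.
  move=> y [/= jy [q iq qy]]; exists q => //; split=> //.
  by move: jy; rewrite -qy chartK.
apply: (filterS sub); exact: filterI.
Qed.

End Domains.
Arguments overlap_open {R m M} i j.

Lemma sum_delta_row (R : pzSemiRingType) m (a : 'I_m) (F : 'I_m -> R) :
  \sum_b (delta_mx 0 a : 'rV[R]_m) 0 b * F b = F a.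
Proof.
rewrite (bigD1 a)//= mxE !eqxx mul1r big1 ?addr0// => b /negPf ba.
by rewrite mxE ba andbF mul0r.
Qed.

Section Connection.
Variables (R : realType) (m : nat) (M : smooth_manifold R m).
Variable nabla : affine_connection M.
Implicit Types (i j : chart_idx M) (x : 'rV[R]_m) (a b c d : 'I_m).
Local Notation Gamma := (christoffel nabla).

Definition conn_mx i a x : 'M[R]_m := \matrix_(b, k) Gamma i x a b k.

Definition curv_mx i a b x : 'M[R]_m := \matrix_(c, d) Rm nabla i x a b c d.

Lemma conn_mx_smooth i a b k : smooth_on (coord_dom i) (fun x => conn_mx i a x b k).
Proof.
have -> : (fun x => conn_mx i a x b k) = fun x => Gamma i x a b k.
  by apply/funext => x; rewrite mxE.
exact: christoffel_smooth.
Qed.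

Lemma conn_mx_differentiable i a x : coord_dom i x ->
  mdifferentiable (conn_mx i a) x.
Proof. by move=> ix b k; exact: smooth_on_differentiable (@conn_mx_smooth i a b k) ix. Qed.

Lemma dirderiv_coord a f x : dirderiv (coord_field a) f x = pderiv a f x.
Proof. exact: sum_delta_row. Qed.

Lemma cov_coord i a (Y : 'rV[R]_m -> 'rV[R]_m) x k :
  cov nabla i (coord_field a) Y x 0 k =
  pderiv a (fun z => Y z 0 k) x + \sum_b Gamma i x a b k * Y x 0 b.
Proof.
rewrite [LHS]mxE dirderiv_coord; congr (_ + _).
rewrite exchange_big; apply: eq_bigr => b _ /=.
rewrite -(sum_delta_row a (fun a => Gamma i x a b k * Y x 0 b)).
by apply: eq_bigr => a' _; rewrite /coord_field; ring.
Qed.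

Lemma cov_coord2 i a b x :
  cov nabla i (coord_field a) (coord_field b) x = row b (conn_mx i a x).
Proof.
apply/rowP => k; rewrite cov_coord 2![RHS]mxE.
rewrite pderiv_cst add0r -(sum_delta_row b (fun b => Gamma i x a b k)).
by apply: eq_bigr => c _; rewrite mulrC.
Qed.

Lemma lie_bracket_coord a b : lie_bracket (coord_field a) (coord_field b) =
  (fun=> 0) :> ('rV[R]_m -> 'rV[R]_m).
Proof.
apply/funext => x; apply/rowP => k.
have D0 e f : pderiv e (fun z => coord_field f z 0 k) x = 0 :> R.
  exact: pderiv_cst.
by rewrite mxE !dirderiv_coord !D0 mxE subrr.
Qed.

Lemma cov0 i (Y : 'rV[R]_m -> 'rV[R]_m) x : cov nabla i (fun=> 0) Y x = 0.
Proof.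
apply/rowP => k; rewrite [RHS]mxE [LHS]mxE /dirderiv.
rewrite big1 ?add0r => [|a _]; last by rewrite mxE mul0r.
by rewrite big1// => a _; rewrite big1// => b _; rewrite mxE mulr0 mul0r.
Qed.

(** In a coordinate frame the brackets vanish and the second covariant
    derivatives reduce to derivatives and products of the connection matrices. *)
Lemma RmE i a b c d x : Rm nabla i x a b c d =
  mderiv a (conn_mx i b) x c d - mderiv b (conn_mx i a) x c d
  + (conn_mx i b x *m conn_mx i a x) c d - (conn_mx i a x *m conn_mx i b x) c d.
Proof.
rewrite /Rm /curvature lie_bracket_coord cov0 subr0.
have half a' b' : cov nabla i (coord_field a')
    (cov nabla i (coord_field b') (coord_field c)) x 0 d =
    mderiv a' (conn_mx i b') x c d + (conn_mx i b' x *m conn_mx i a' x) c d.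
  rewrite cov_coord mderivE; congr (_ + _).
    have -> : (fun z => cov nabla i (coord_field b') (coord_field c) z 0 d) =
              (fun z => conn_mx i b' z c d) by apply/funext => z; rewrite cov_coord2 mxE.
    by [].
  rewrite mxE; apply: eq_bigr => e _; rewrite cov_coord2 mxE mulrC.
  by congr (_ * _); rewrite mxE.
have mB (A B : 'rV[R]_m) : (A - B) 0 d = A 0 d - B 0 d by rewrite !mxE.
by rewrite mB !half; ring.
Qed.

Lemma curv_mxE i a b x : curv_mx i a b x = curv_form (conn_mx i) a b x.
Proof.
apply/matrixP => c d; rewrite [LHS]mxE RmE /curv_form.
have mB (A B : 'M[R]_m) : (A - B) c d = A c d - B c d by rewrite !mxE.
have mD (A B : 'M[R]_m) : (A + B) c d = A c d + B c d by rewrite !mxE.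
by rewrite mB mD mB.
Qed.

(** Component functions are smooth because the curvature is a polynomial in the
    Christoffel symbols and their first derivatives. *)
Lemma Rm_smooth i a b c d : smooth_on (coord_dom i) (fun x => Rm nabla i x a b c d).
Proof.
have oD := coord_dom_open i.
pose G e p q x := conn_mx i e x p q.
have -> : (fun x => Rm nabla i x a b c d) = fun x =>
    pderiv a (G b c d) x - pderiv b (G a c d) x +
    \sum_e G b c e x * G a e d x - \sum_e G a c e x * G b e d x.
  apply/funext => x; rewrite RmE 2!mderivE.
  by congr (_ - _ + _ - _); rewrite mxE.
have sG e p q : smooth_on (coord_dom i) (G e p q) by exact: conn_mx_smooth.
apply: smooth_onB => //; last by apply: smooth_on_sum => // e; exact: smooth_onM.
apply: smooth_onD => //; last by apply: smooth_on_sum => // e; exact: smooth_onM.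
by apply: smooth_onB => //; exact: smooth_on_pderiv.
Qed.

Hypothesis tf : torsion_free nabla.

Lemma christoffel_sym i x a b k : coord_dom i x -> Gamma i x a b k = Gamma i x b a k.
Proof.
move=> ix; have := tf ix a b.
rewrite /torsion !cov_coord2 lie_bracket_coord subr0 => /subr0_eq /rowP/(_ k).
by rewrite !mxE.
Qed.

Lemma Rm_bianchi i x a b c d : coord_dom i x ->
  Rm nabla i x a b c d + Rm nabla i x b c a d + Rm nabla i x c a b d = 0.
Proof.
move=> ix; have oD := coord_dom_open i.
pose dG a b c := mderiv a (conn_mx i b) x c d.
pose GG b c a := (conn_mx i b x *m conn_mx i a x) c d.
have RE p q r : Rm nabla i x p q r d = dG p q r - dG q p r + GG q r p - GG p r q.
  exact: RmE.
have dGs p q r : dG p q r = dG p r q.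
  rewrite /dG 2!mderivE; apply: (pderiv_ext p oD _ ix) => z /set_mem iz.
  by rewrite !mxE; exact: christoffel_sym.
have GGs p q r : GG p q r = GG q p r.
  rewrite /GG [LHS]mxE [RHS]mxE; apply: eq_bigr => e _; congr (_ * _).
  by rewrite !mxE; exact: christoffel_sym.
rewrite !RE (dGs c b) (dGs a c) (dGs b a) (GGs c b) (GGs a c) (GGs b a); ring.
Qed.

End Connection.

(** * Changes of coordinates *)

Section Pullback.
Variables (R : realType) (m : nat).
Local Notation rV := 'rV[R]_m.
Implicit Types (D : set rV) (x z : rV) (a b c d : 'I_m).

(** The pullback by [y], with Jacobian matrix [J], of the matrix-valued one-form
    with components [H]. *)
Definition pull_form (y : rV -> rV) (J : rV -> 'M[R]_m) (H : 'I_m -> rV -> 'M[R]_m)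
    (a : 'I_m) (z : rV) : 'M[R]_m := \sum_c J z a c *: H c (y z).

Lemma pull_formE y J H a z p q :
  pull_form y J H a z p q = \sum_c J z a c * H c (y z) p q.
Proof. by rewrite summxE; apply: eq_bigr => c _; rewrite mxE. Qed.

Variables (D : set rV) (y : rV -> rV) (J : rV -> 'M[R]_m) (H : 'I_m -> rV -> 'M[R]_m).
Variable (x : rV).
Hypotheses (oD : open D) (Dx : D x).
Hypothesis y_smooth : forall k, smooth_on D (fun z => y z 0 k).
Hypothesis J_eq : forall z a c, J z a c = pderiv a (fun z => y z 0 c) z.
Hypothesis dH : forall c, mdifferentiable (H c) (y x).

Lemma jacobian_smooth a c : smooth_on D (fun z => J z a c).
Proof.
have -> : (fun z => J z a c) = pderiv a (fun z => y z 0 c).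
  by apply/funext => z; exact: J_eq.
exact: smooth_on_pderiv.
Qed.

Lemma jacobian_differentiable a c : differentiable (fun z => J z a c) x.
Proof. exact: smooth_on_differentiable (@jacobian_smooth a c) Dx. Qed.

Lemma mderiv_jacobian_sym a b c : mderiv a J x b c = mderiv b J x a c.
Proof.
rewrite 2!mderivE.
have E e : (fun z => J z e c) = pderiv e (fun z => y z 0 c).
  by apply/funext => z; exact: J_eq.
by rewrite 2!E; exact: (pderiv_comm a b oD (y_smooth c) Dx).
Qed.

Lemma pullback_differentiable c p q : differentiable (fun z => H c (y z) p q) x.
Proof.
have dy : differentiable y x.
  by apply: differentiable_row => k; exact: smooth_on_differentiable (y_smooth k) Dx.
exact: (differentiable_comp dy (dH c p q)).
Qed.

Lemma pull_form_differentiable a : mdifferentiable (pull_form y J H a) x.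
Proof.
move=> p q; have -> : (fun z => pull_form y J H a z p q) =
    \sum_c (fun z => J z a c * H c (y z) p q).
  by apply/funext => z; rewrite fct_sumE pull_formE.
apply: differentiable_sum => c; apply: differentiableM.
  exact: jacobian_differentiable.
exact: pullback_differentiable.
Qed.

Lemma mderiv_pull_form a b p q :
  mderiv a (pull_form y J H b) x p q =
  \sum_d mderiv a J x b d * H d (y x) p q +
  \sum_c \sum_d J x a c * J x b d * mderiv c (H d) (y x) p q.
Proof.
rewrite mderivE.
have -> : (fun z => pull_form y J H b z p q) =
    (fun z => \sum_d J z b d * H d (y z) p q).
  by apply/funext => z; rewrite pull_formE.
rewrite pderiv_sum => [|d]; last first.
  apply: differentiableM; first exact: jacobian_differentiable.
  exact: pullback_differentiable.
rewrite exchange_big -big_split; apply: eq_bigr => d _.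
rewrite pderivM; [|exact: jacobian_differentiable|exact: pullback_differentiable].
rewrite mderivE; congr (_ + _).
rewrite (@pderiv_comp _ _ _ (fun w => H d w p q)); first last.
- by move=> k; exact: smooth_on_differentiable (y_smooth k) Dx.
- exact: dH.
rewrite mulr_sumr; apply: eq_bigr => c _; rewrite mderivE -J_eq.
by rewrite mulrCA mulrA.
Qed.

Lemma mul_pull_form a b p q :
  (pull_form y J H b x *m pull_form y J H a x) p q =
  \sum_c \sum_d J x a c * J x b d * (H d (y x) *m H c (y x)) p q.
Proof.
rewrite /pull_form mulmx_sumr summxE; apply: eq_bigr => c _.
rewrite mulmx_suml summxE; apply: eq_bigr => d _.
by rewrite -scalemxAl -scalemxAr scalerA mxE [J x b d * _]mulrC.
Qed.

(** The derivatives of the Jacobian cancel by symmetry of the second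
    derivatives of the coordinate change. *)
Lemma curv_form_pullback a b :
  curv_form (pull_form y J H) a b x =
  \sum_c \sum_d (J x a c * J x b d) *: curv_form H c d (y x).
Proof.
apply/matrixP => p q.
have mB (A B : 'M[R]_m) : (A - B) p q = A p q - B p q by rewrite !mxE.
have mD (A B : 'M[R]_m) : (A + B) p q = A p q + B p q by rewrite !mxE.
have -> : (\sum_c \sum_d (J x a c * J x b d) *: curv_form H c d (y x)) p q =
    \sum_c \sum_d (J x a c * J x b d * mderiv c (H d) (y x) p q)
  - \sum_c \sum_d (J x a c * J x b d * mderiv d (H c) (y x) p q)
  + \sum_c \sum_d (J x a c * J x b d * (H d (y x) *m H c (y x)) p q)
  - \sum_c \sum_d (J x a c * J x b d * (H c (y x) *m H d (y x)) p q).
  rewrite summxE -!sumrB -big_split -sumrB; apply: eq_bigr => c _.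
  rewrite summxE -!sumrB -big_split -sumrB; apply: eq_bigr => d _.
  by rewrite [LHS]mxE /curv_form mB mD mB /=; ring.
rewrite /curv_form mB mD mB !mderiv_pull_form !mul_pull_form.
have sw (F : 'I_m -> 'I_m -> R) :
    \sum_c \sum_d J x b c * J x a d * F c d = \sum_c \sum_d J x a c * J x b d * F d c.
  rewrite exchange_big; apply: eq_bigr => c _; apply: eq_bigr => d _.
  by rewrite [J x b d * _]mulrC.
rewrite (sw (fun c d => mderiv c (H d) (y x) p q)).
rewrite (sw (fun c d => (H d (y x) *m H c (y x)) p q)).
have -> : \sum_d mderiv b J x a d * H d (y x) p q =
          \sum_d mderiv a J x b d * H d (y x) p q.
  by apply: eq_bigr => d _; rewrite mderiv_jacobian_sym.
by ring.
Qed.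

End Pullback.

Section Transformation.
Variables (R : realType) (m : nat) (M : smooth_manifold R m).
Implicit Types (i j : chart_idx M) (x : 'rV[R]_m) (a b c d : 'I_m).

Definition jac_mx i j x : 'M[R]_m := \matrix_(a, c) jac i j x a c.

Lemma cov2_change_mx (T : cov2_tensor M) i j x : overlap i j x ->
  T i x = jac_mx i j x *m T j (transition i j x) *m (jac_mx i j x)^T.
Proof.
move=> ijx; apply/matrixP => a b; rewrite (comp2_change T ijx) exchange_big mxE.
apply: eq_bigr => d _; rewrite mxE mulr_suml; apply: eq_bigr => c _.
by rewrite !mxE mulrAC.
Qed.

(** Nondegeneracy of the symplectic form in both charts makes the Jacobian
    invertible, which spares inverting the coordinate change. *)
Lemma jac_mx_unit (Omega : symplectic_form M) i j x : overlap i j x ->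
  jac_mx i j x \in unitmx.
Proof.
move=> ijx; have := form2_nondegenerate Omega (overlap_coord_dom ijx).
by rewrite (cov2_change_mx Omega ijx) !unitmx_mul => /andP[/andP[]].
Qed.

Variable nabla : affine_connection M.

(** The transformation law of the Christoffel symbols is the gauge equation
    relating the connection form to the pullback of the one of the other chart. *)
Lemma conn_mx_change i j x a : overlap i j x ->
  conn_mx nabla i a x *m jac_mx i j x =
  mderiv a (jac_mx i j) x + jac_mx i j x *m
    pull_form (transition i j) (jac_mx i j) (conn_mx nabla j) a x.
Proof.
move=> ijx; apply/matrixP => b l; rewrite [LHS]mxE [RHS]mxE mderivE.
have -> : (fun z => jac_mx i j z b l) = (fun z => jac i j z b l).
  by apply/funext => z; rewrite mxE.
rewrite (eq_bigr (fun k => christoffel nabla i x a b k * jac i j x k l)); last first.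
  by move=> k _; rewrite !mxE.
rewrite christoffel_change//; congr (_ + _).
rewrite [RHS]mxE exchange_big; apply: eq_bigr => d _.
rewrite pull_formE mulr_sumr; apply: eq_bigr => c _.
rewrite [jac_mx i j x b d]mxE [jac_mx i j x a c]mxE [conn_mx _ _ _ _ _ _]mxE.
by rewrite mulrCA mulrA.
Qed.

(** Tensoriality of the curvature: it is conjugated by the gauge and natural
    under pullback. *)
Lemma curv_mx_change i j x a b : overlap i j x ->
  curv_mx nabla i a b x *m jac_mx i j x =
  jac_mx i j x *m \sum_c \sum_d (jac_mx i j x a c * jac_mx i j x b d) *:
    curv_mx nabla j c d (transition i j x).
Proof.
move=> ijx; have oD := overlap_open i j.
have ix := overlap_coord_dom ijx.
have jy := transition_coord_dom ijx.
have ys k : smooth_on (overlap i j) (fun z => transition i j z 0 k).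
  exact: (@transition_smooth _ _ M i j k).
have JE z e c : jac_mx i j z e c = pderiv e (fun z => transition i j z 0 c) z.
  by rewrite mxE.
have dH c := conn_mx_differentiable nabla c jy.
rewrite curv_mxE.
rewrite (curv_form_gauge (D := overlap i j)
  (th' := pull_form (transition i j) (jac_mx i j) (conn_mx nabla j)) a b oD ijx).
- rewrite (curv_form_pullback oD ijx ys JE dH).
  congr (_ *m _); apply: eq_bigr => c _; apply: eq_bigr => d _.
  by rewrite curv_mxE.
- by move=> e c; exact: (jacobian_smooth ys JE).
- by move=> c; exact: conn_mx_differentiable.
- by move=> c; exact: (pull_form_differentiable ijx ys JE dH).
- by move=> c z ijz; exact: conn_mx_change.
Qed.

Variable Omega : symplectic_form M.

(** In the trace, the conjugating Jacobian and its inverse meet along the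
    contracted index and cancel. *)
Lemma ricci_change i j x : overlap i j x -> forall a b,
  ricci nabla i x a b = \sum_c \sum_d jac i j x a c * jac i j x b d *
    ricci nabla j (transition i j x) c d.
Proof.
move=> ijx a b; have Ju := jac_mx_unit Omega ijx.
set J := jac_mx i j x in Ju; set y := transition i j x.
have RE p : Rm nabla i x p a b p = \sum_c \sum_d (J p c * J a d) *
    (J *m curv_mx nabla j c d y *m invmx J) b p.
  have E := congr1 (mulmx^~ (invmx J)) (curv_mx_change p a ijx).
  rewrite mulmxK// in E; have /matrixP/(_ b p) := E.
  rewrite [LHS]mxE => ->; rewrite mulmx_sumr mulmx_suml summxE.
  apply: eq_bigr => c _; rewrite mulmx_sumr mulmx_suml summxE.
  by apply: eq_bigr => d _; rewrite -scalemxAr -scalemxAl [LHS]mxE.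
rewrite mxE (eq_bigr _ (fun p _ => RE p)) exchange_big.
have -> : \sum_c \sum_p \sum_d J p c * J a d *
      (J *m curv_mx nabla j c d y *m invmx J) b p =
    \sum_c \sum_d J a d * (J *m curv_mx nabla j c d y) b c.
  apply: eq_bigr => c _; rewrite exchange_big; apply: eq_bigr => d _.
  rewrite -[in RHS](mulmxKV Ju (J *m curv_mx nabla j c d y)).
  rewrite [X in _ = _ * X]mxE mulr_sumr; apply: eq_bigr => p _ /=.
  ring.
rewrite exchange_big; apply: eq_bigr => d _.
have -> : \sum_c J a d * (J *m curv_mx nabla j c d y) b c =
    \sum_c \sum_e J a d * J b e * Rm nabla j y c d e c.
  apply: eq_bigr => c _; rewrite [X in _ * X = _]mxE mulr_sumr; apply: eq_bigr => e _.
  by rewrite [curv_mx _ _ _ _ _ _ _]mxE mulrA.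
rewrite exchange_big; apply: eq_bigr => e _.
by rewrite [ricci _ _ _ _ _]mxE mulr_sumr; apply: eq_bigr => c _; rewrite !mxE.
Qed.

End Transformation.

(** * Parallel tensors and the symmetries of symplectic curvature *)

Lemma mxtrace_sym_skew (R : realFieldType) m (S K : 'M[R]_m) :
  S^T = S -> K^T = - K -> \tr (S *m K) = 0.
Proof.
move=> sS sK; have : \tr (S *m K) = - \tr (S *m K).
  by rewrite -[LHS]mxtrace_tr trmx_mul sS sK mulNmx linearN /= mxtrace_mulC.
lra.
Qed.

Lemma invmx_skew (R : comUnitRingType) m (P : 'M[R]_m) :
  P \in unitmx -> P^T = - P -> (invmx P)^T = - invmx P.
Proof.
move=> Pu PN; rewrite -[LHS](mulmxK Pu) -[X in _ *m X *m _]opprK -PN mulmxN.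
by rewrite -trmx_mul mulmxV// trmx1 mulNmx mul1mx.
Qed.

(** The algebra behind the Ricci identity: [A] and [B] stand for two connection
    matrices, [Da] and [Db] for their crossed derivatives, [t] for the tensor. *)
Lemma mx_ricci_identity (R : realFieldType) m (A B Da Db t : 'M[R]_m) :
  Da *m t + B *m (A *m t + t *m A^T) + ((A *m t + t *m A^T) *m B^T + t *m Da^T) =
  Db *m t + A *m (B *m t + t *m B^T) + ((B *m t + t *m B^T) *m A^T + t *m Db^T) ->
  (Da - Db + B *m A - A *m B) *m t + t *m (Da - Db + B *m A - A *m B)^T = 0.
Proof.
have -> : (Da - Db + B *m A - A *m B)^T =
    Da^T - Db^T + A^T *m B^T - B^T *m A^T.
  by rewrite -!trmx_mul; apply/matrixP => p q; rewrite ![in LHS]mxE ![in RHS]mxE.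
rewrite !mulmxDl !mulmxDr !mulNmx !mulmxN !mulmxA.
move: (Da *m t) (Db *m t) (t *m Da^T) (t *m Db^T).
move: (A *m B *m t) (B *m A *m t) (A *m t *m B^T) (B *m t *m A^T).
move: (t *m A^T *m B^T) (t *m B^T *m A^T).
move=> A1 A2 A3 A4 A5 A6 A7 A8 A9 A10 /matrixP H; apply/matrixP => p q.
by move: (H p q); rewrite !mxE; lra.
Qed.

Section Parallel.
Variables (R : realType) (m : nat) (M : smooth_manifold R m).
Variable nabla : affine_connection M.
Implicit Types (i j : chart_idx M) (x : 'rV[R]_m) (a b c d e : 'I_m).
Implicit Types T : chart_idx M -> 'rV[R]_m -> 'M[R]_m.

Lemma cov_deriv2E T i x e a b : cov_deriv2 nabla T i x e a b =
  (mderiv e (T i) x - conn_mx nabla i e x *m T i x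
   - T i x *m (conn_mx nabla i e x)^T) a b.
Proof.
have mB (A B : 'M[R]_m) : (A - B) a b = A a b - B a b by rewrite !mxE.
rewrite 2!mB mderivE /cov_deriv2; congr (_ - _ - _); rewrite [RHS]mxE.
  by apply: eq_bigr => p _; rewrite [conn_mx _ _ _ _ _ _]mxE.
apply: eq_bigr => p _; rewrite [_^T _ _]mxE [conn_mx _ _ _ _ _ _]mxE.
by rewrite mulrC.
Qed.

Lemma parallel2P T : parallel2 nabla T <->
  forall i x, coord_dom i x -> forall e, mderiv e (T i) x =
    conn_mx nabla i e x *m T i x + T i x *m (conn_mx nabla i e x)^T.
Proof.
split=> H i x ix e.
  apply/eqP; rewrite -subr_eq0 opprD addrA; apply/eqP/matrixP => a b.
  by rewrite -cov_deriv2E H// mxE.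
by move=> a b; rewrite cov_deriv2E H// -addrA -opprD subrr mxE.
Qed.

Lemma parallel2_scale (c : R) (T : cov2_tensor M) T' :
  (forall i x, coord_dom i x -> T' i x = c *: T i x) ->
  parallel2 nabla T -> parallel2 nabla T'.
Proof.
move=> T'E /parallel2P pT; apply/parallel2P => i x ix e.
rewrite T'E// -scalemxAr -scalemxAl -scalerDr -pT//.
apply/matrixP => a b; rewrite [RHS]mxE 2!mderivE.
have dT := smooth_on_differentiable (@comp2_smooth _ _ _ T i a b) ix.
rewrite -pderivZ//; apply: (pderiv_ext e (coord_dom_open i) _ ix) => z /set_mem iz.
by rewrite T'E// mxE.
Qed.

(** Commuting the two covariant derivatives of a parallel tensor: the curvature
    acts on it trivially. *)
Lemma parallel2_ricci_identity (T : cov2_tensor M) i x a b :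
  parallel2 nabla T -> coord_dom i x ->
  curv_mx nabla i a b x *m T i x + T i x *m (curv_mx nabla i a b x)^T = 0.
Proof.
move=> /parallel2P pT ix; have oD := coord_dom_open i.
have dT : mdifferentiable (T i) x.
  by move=> p q; exact: smooth_on_differentiable (@comp2_smooth _ _ _ T i p q) ix.
have dG e := conn_mx_differentiable nabla e ix.
have dE e f : mderiv f (mderiv e (T i)) x =
    mderiv f (conn_mx nabla i e) x *m T i x
    + conn_mx nabla i e x *m mderiv f (T i) x
    + (mderiv f (T i) x *m (conn_mx nabla i e x)^T
    + T i x *m (mderiv f (conn_mx nabla i e) x)^T).
  have dGt : mdifferentiable (fun z => (conn_mx nabla i e z)^T) x.
    exact: mdifferentiable_tr.
  rewrite -mderiv_tr -!mderivM// -mderivD//; try exact: mdifferentiableM.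
  by apply: (mderiv_ext f oD _ ix) => z /set_mem iz; exact: pT.
have C := mderiv_comm a b oD (@comp2_smooth _ _ _ T i) ix.
move: C; rewrite !dE !pT// curv_mxE /curv_form.
exact: mx_ricci_identity.
Qed.

End Parallel.

Section SymplecticCurvature.
Variables (R : realType) (m : nat) (M : smooth_manifold R m).
Variables (nabla : affine_connection M) (Omega : symplectic_form M).
Hypothesis symp : symplectic_connection nabla Omega.
Implicit Types (i j : chart_idx M) (x : 'rV[R]_m) (a b c d e : 'I_m).

Lemma Rm_lowE i x a b c d :
  Rm_low nabla Omega i x a b c d = (curv_mx nabla i a b x *m Omega i x) c d.
Proof. by rewrite mxE; apply: eq_bigr => p _; rewrite [curv_mx _ _ _ _ _ _ _]mxE. Qed.

Lemma form2_tr i x : coord_dom i x -> (Omega i x)^T = - Omega i x.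
Proof. by move=> ix; apply/matrixP => a b; rewrite !mxE form2_skew. Qed.

(** The Ricci identity for the symplectic form says that its product with the
    curvature endomorphism is a symmetric matrix. *)
Lemma Rm_low_sym i x a b c d : coord_dom i x ->
  Rm_low nabla Omega i x a b c d = Rm_low nabla Omega i x a b d c.
Proof.
move=> ix; rewrite !Rm_lowE.
have /eqP := parallel2_ricci_identity a b symp.2 ix; rewrite addr_eq0 => /eqP E.
rewrite [in LHS]E -[in LHS](opprK (Omega i x)) -form2_tr// mulNmx opprK.
by rewrite -trmx_mul mxE.
Qed.

Lemma Rm_low_skew i x a b c d :
  Rm_low nabla Omega i x b a c d = - Rm_low nabla Omega i x a b c d.
Proof.
rewrite /Rm_low -sumrN; apply: eq_bigr => p _.
by rewrite Rm_skew mulNr.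
Qed.

Lemma Rm_low_bianchi i x a b c d : coord_dom i x ->
  Rm_low nabla Omega i x a b c d + Rm_low nabla Omega i x b c a d
  + Rm_low nabla Omega i x c a b d = 0.
Proof.
move=> ix; rewrite /Rm_low -!big_split big1// => p _ /=.
by rewrite -!mulrDl Rm_bianchi ?mul0r//; exact: symp.1.
Qed.

Lemma curv_mx_low i x a b : coord_dom i x ->
  curv_mx nabla i a b x =
  (\matrix_(c, d) Rm_low nabla Omega i x a b c d) *m invmx (Omega i x).
Proof.
move=> ix; have -> : \matrix_(c, d) Rm_low nabla Omega i x a b c d =
    curv_mx nabla i a b x *m Omega i x.
  by apply/matrixP => c d; rewrite mxE Rm_lowE.
by rewrite mulmxK//; exact: form2_nondegenerate.
Qed.

(** By the first Bianchi identity the antisymmetric part of the Ricci tensor is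
    the trace of the curvature endomorphism, which pairs a symmetric matrix with
    the skew inverse of the symplectic form. *)
Lemma ricci_sym i x a b : coord_dom i x ->
  ricci nabla i x a b = ricci nabla i x b a.
Proof.
move=> ix; have tr0 : \sum_p Rm nabla i x a b p p = 0.
  have <- : \tr (curv_mx nabla i a b x) = \sum_p Rm nabla i x a b p p.
    by apply: eq_bigr => p _; rewrite mxE.
  rewrite curv_mx_low//; apply: mxtrace_sym_skew; last first.
    by apply: invmx_skew; [exact: form2_nondegenerate|exact: form2_tr].
  by apply/matrixP => c d; rewrite !mxE Rm_low_sym.
have E : \sum_p (Rm nabla i x p a b p + Rm nabla i x a b p p
    + Rm nabla i x b p a p) = 0.
  by apply: big1 => p _; exact: (Rm_bianchi symp.1 p a b p ix).
rewrite !big_split /= tr0 addr0 in E.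
rewrite !mxE; apply/eqP; rewrite -subr_eq0 -sumrN; apply/eqP; apply: etrans E.
by congr (_ + _); apply: eq_bigr => p _; rewrite (Rm_skew nabla i x p b a p).
Qed.

End SymplecticCurvature.

(** * Algebra of curvature-type tensors *)

(** Polarizing B(X, Y, X, X) = 0 once in X gives B(Z, Y, X, X) = -2 s(Y, Z) with
    s(Y, Z) = B(X, Y, Z, X). Skewness makes s antisymmetric, then the Bianchi
    identity gives s = 3 (- s), hence s = 0; polarizing in the last two arguments
    concludes. *)
Lemma curvature_like_eq0 (V : zmodType) (R : realFieldType) (B : V -> V -> V -> V -> R) :
  (forall X X' Y Z W, B (X + X') Y Z W = B X Y Z W + B X' Y Z W) ->
  (forall X Y Z Z' W, B X Y (Z + Z') W = B X Y Z W + B X Y Z' W) ->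
  (forall X Y Z W, B Y X Z W = - B X Y Z W) ->
  (forall X Y Z W, B X Y Z W = B X Y W Z) ->
  (forall X Y Z W, B X Y Z W + B Y Z X W + B Z X Y W = 0) ->
  (forall X Y, B X Y X X = 0) ->
  forall X Y Z W, B X Y Z W = 0.
Proof.
move=> add1 add3 skew sym bianchi diag.
have add4 X Y Z W W' : B X Y Z (W + W') = B X Y Z W + B X Y Z W'.
  by rewrite sym add3 !(sym X Y _ Z).
have lin X Y Z : B Z Y X X = - 2 * B X Y Z X.
  (* B(X + tZ, Y, X + tZ, X + tZ) is t (B(Z, Y, X, X) + 2 B(X, Y, Z, X)) plus a
     multiple of t ^ 2; the values 1 and 2 of t isolate the linear term. *)
  have q1 := diag (X + Z) Y; have q2 := diag (X + Z + Z) Y.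
  have := diag X Y; have := diag Z Y.
  move: q1 q2; rewrite !(add1, add3, add4) !(sym _ _ X Z); lra.
have s0 X Y Z : B X Y Z X = 0.
  have := bianchi X Y Z X; have := skew X Z Y X; have := skew Y Z X X.
  by have := lin X Y Z; have := lin X Z Y; lra.
have d0 X Y Z : B X Y Z Z = 0 by rewrite lin s0 mulr0.
move=> X Y Z W; have := d0 X Y (Z + W); rewrite add3 !add4 !d0 (sym X Y W Z); lra.
Qed.

Section Form4.
Variables (R : realFieldType) (m : nat).
Implicit Types (X Y Z W : 'rV[R]_m) (P Q S : 'M[R]_m) (a b c d : 'I_m).
Implicit Types T : 'I_m -> 'I_m -> 'I_m -> 'I_m -> R.

Definition form2_at P X Y : R := \sum_a \sum_b X 0 a * P a b * Y 0 b.

Definition form4_at T X Y Z W : R :=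
  \sum_a \sum_b \sum_c \sum_d X 0 a * Y 0 b * Z 0 c * W 0 d * T a b c d.

Lemma eq_form4 T T' X Y Z W : (forall a b c d, T a b c d = T' a b c d) ->
  form4_at T X Y Z W = form4_at T' X Y Z W.
Proof.
move=> TE; apply: eq_bigr => a _; apply: eq_bigr => b _; apply: eq_bigr => c _.
by apply: eq_bigr => d _; rewrite TE.
Qed.

Lemma form4_swap12 T X Y Z W :
  form4_at T Y X Z W = form4_at (fun a b c d => T b a c d) X Y Z W.
Proof.
rewrite /form4_at exchange_big; apply: eq_bigr => a _; apply: eq_bigr => b _.
by apply: eq_bigr => c _; apply: eq_bigr => d _; rewrite [Y 0 b * _]mulrC.
Qed.

Lemma form4_swap23 T X Y Z W :
  form4_at T X Z Y W = form4_at (fun a b c d => T a c b d) X Y Z W.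
Proof.
apply: eq_bigr => a _; rewrite exchange_big; apply: eq_bigr => b _.
by apply: eq_bigr => c _; apply: eq_bigr => d _; rewrite [X 0 a * _ * _]mulrAC.
Qed.

Lemma form4_swap34 T X Y Z W :
  form4_at T X Y W Z = form4_at (fun a b c d => T a b d c) X Y Z W.
Proof.
apply: eq_bigr => a _; apply: eq_bigr => b _; rewrite exchange_big.
by apply: eq_bigr => c _; apply: eq_bigr => d _; rewrite [_ * W 0 d * _]mulrAC.
Qed.

Lemma form4_cycle T X Y Z W :
  form4_at T Y Z X W = form4_at (fun a b c d => T b c a d) X Y Z W.
Proof. by rewrite form4_swap23 form4_swap12. Qed.

Lemma form4_add1 T X X' Y Z W :
  form4_at T (X + X') Y Z W = form4_at T X Y Z W + form4_at T X' Y Z W.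
Proof.
rewrite -big_split; apply: eq_bigr => a _; rewrite -big_split; apply: eq_bigr => b _.
rewrite -big_split; apply: eq_bigr => c _; rewrite -big_split; apply: eq_bigr => d _.
by rewrite mxE /= !mulrDl.
Qed.

Lemma form4_add3 T X Y Z Z' W :
  form4_at T X Y (Z + Z') W = form4_at T X Y Z W + form4_at T X Y Z' W.
Proof.
rewrite 3!(form4_swap23 T) 3!(form4_swap12 (fun a b c d => T a c b d)).
exact: form4_add1.
Qed.

Lemma form4D T T' X Y Z W :
  form4_at (fun a b c d => T a b c d + T' a b c d) X Y Z W =
  form4_at T X Y Z W + form4_at T' X Y Z W.
Proof.
rewrite -big_split; apply: eq_bigr => a _; rewrite -big_split; apply: eq_bigr => b _.
rewrite -big_split; apply: eq_bigr => c _; rewrite -big_split; apply: eq_bigr => d _.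
by rewrite mulrDr.
Qed.

Lemma form4_0 X Y Z W : form4_at (fun _ _ _ _ => 0) X Y Z W = 0.
Proof.
rewrite /form4_at big1// => a _; rewrite big1// => b _; rewrite big1// => c _.
by rewrite big1// => d _; rewrite mulr0.
Qed.

Lemma form4Z k T X Y Z W :
  form4_at (fun a b c d => k * T a b c d) X Y Z W = k * form4_at T X Y Z W.
Proof.
rewrite mulr_sumr; apply: eq_bigr => a _; rewrite mulr_sumr; apply: eq_bigr => b _.
rewrite mulr_sumr; apply: eq_bigr => c _; rewrite mulr_sumr; apply: eq_bigr => d _.
by rewrite mulrCA.
Qed.

Lemma form4_delta T a b c d :
  form4_at T (delta_mx 0 a) (delta_mx 0 b) (delta_mx 0 c) (delta_mx 0 d) = T a b c d.
Proof.
rewrite -(sum_delta_row a (fun a => T a b c d)); apply: eq_bigr => a' _.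
rewrite -(sum_delta_row b (fun b => T a' b c d)) mulr_sumr; apply: eq_bigr => b' _.
rewrite -(sum_delta_row c (fun c => T a' b' c d)) !mulr_sumr; apply: eq_bigr => c' _.
rewrite -(sum_delta_row d (fun d => T a' b' c' d)) !mulr_sumr.
by apply: eq_bigr => d' _; rewrite !mulrA.
Qed.

Lemma form4_prod P Q X Y Z W :
  form4_at (fun a b c d => P a b * Q c d) X Y Z W =
  form2_at P X Y * form2_at Q Z W.
Proof.
rewrite mulr_suml; apply: eq_bigr => a _; rewrite mulr_suml; apply: eq_bigr => b _.
rewrite mulr_sumr; apply: eq_bigr => c _; rewrite mulr_sumr; apply: eq_bigr => d _.
ring.
Qed.

(** The symplectic counterpart of the constant curvature tensor. Up to a factor
    it is the part of a symplectic curvature tensor determined by its Ricci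
    tensor [S], when [P] is the symplectic form. *)
Definition model_curv P S a b c d : R :=
  2^-1 * (P a c * S d b + P a d * S c b)
  - 2^-1 * (P b c * S d a + P b d * S c a) + P a b * S c d.

Lemma form4_model P S X Y Z W :
  form4_at (model_curv P S) X Y Z W =
  2^-1 * (form2_at P X Z * form2_at S W Y + form2_at P X W * form2_at S Z Y)
  - 2^-1 * (form2_at P Y Z * form2_at S W X + form2_at P Y W * form2_at S Z X)
  + form2_at P X Y * form2_at S Z W.
Proof.
have acdb : form4_at (fun a b c d => P a c * S d b) X Y Z W =
    form2_at P X Z * form2_at S W Y.
  rewrite -(form4_swap23 (fun a c b d => P a c * S d b)).
  by rewrite -(form4_swap34 (fun a c d b => P a c * S d b)) form4_prod.
have adcb : form4_at (fun a b c d => P a d * S c b) X Y Z W =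
    form2_at P X W * form2_at S Z Y.
  rewrite -(form4_swap34 (fun a b d c => P a d * S c b)).
  rewrite -(form4_swap23 (fun a d b c => P a d * S c b)).
  by rewrite -(form4_swap34 (fun a d c b => P a d * S c b)) form4_prod.
have bcda : form4_at (fun a b c d => P b c * S d a) X Y Z W =
    form2_at P Y Z * form2_at S W X.
  rewrite -(form4_swap12 (fun b a c d => P b c * S d a)).
  rewrite -(form4_swap23 (fun b c a d => P b c * S d a)).
  by rewrite -(form4_swap34 (fun b c d a => P b c * S d a)) form4_prod.
have bdca : form4_at (fun a b c d => P b d * S c a) X Y Z W =
    form2_at P Y W * form2_at S Z X.
  rewrite -(form4_swap12 (fun b a c d => P b d * S c a)).
  rewrite -(form4_swap34 (fun b a d c => P b d * S c a)).
  rewrite -(form4_swap23 (fun b d a c => P b d * S c a)).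
  by rewrite -(form4_swap34 (fun b d c a => P b d * S c a)) form4_prod.
rewrite -acdb -adcb -bcda -bdca -form4_prod -!form4D -mulrN -!form4Z.
have N1 T : - form4_at T X Y Z W = form4_at (fun a b c d => -1 * T a b c d) X Y Z W.
  by rewrite form4Z mulN1r.
by rewrite N1 -form4Z -!form4D; apply: eq_form4 => a b c d; rewrite /model_curv; ring.
Qed.

Lemma model_curv_skew P S a b c d : P^T = - P ->
  model_curv P S b a c d = - model_curv P S a b c d.
Proof.
move=> /matrixP PN; have PE p q : P q p = - P p q by have := PN p q; rewrite !mxE.
by rewrite /model_curv (PE a b); ring.
Qed.

Lemma model_curv_sym P S a b c d : S^T = S ->
  model_curv P S a b c d = model_curv P S a b d c.
Proof.
move=> /matrixP SN; have SE p q : S q p = S p q by have := SN p q; rewrite !mxE.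
by rewrite /model_curv (SE c d); ring.
Qed.

Lemma model_curv_bianchi P S a b c d : P^T = - P -> S^T = S ->
  model_curv P S a b c d + model_curv P S b c a d + model_curv P S c a b d = 0.
Proof.
move=> /matrixP PN; have PE p q : P q p = - P p q by have := PN p q; rewrite !mxE.
move=> /matrixP SN; have SE p q : S q p = S p q by have := SN p q; rewrite !mxE.
rewrite /model_curv (PE a b) (PE b c) (PE a c) (SE a d) (SE b d) (SE c d).
rewrite (SE b c) (SE a c) (SE a b); lra.
Qed.

(** The contraction that turns the lowered curvature into the Ricci tensor. Of
    the five terms of the model, one gives the dimension, one pairs a symmetric
    with a skew matrix and vanishes, and the other three give [S]. *)
Lemma model_curv_trace P S a b : P \in unitmx -> P^T = - P -> S^T = S ->
  \sum_p \sum_l model_curv P S p a b l * invmx P l p = (m.+2)%:R / 2 * S a b.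
Proof.
move=> Pu PN SN; set K := invmx P.
have SE p q : S q p = S p q by have /matrixP/(_ p q) := SN; rewrite mxE.
have KN : K^T = - K by exact: invmx_skew.
have KP := mulVmx Pu; have PK := mulmxV Pu; rewrite -/K in KP PK.
have KPE l q : \sum_p K l p * P p q = (l == q)%:R.
  by have /matrixP/(_ l q) := KP; rewrite !mxE.
have PKE l q : \sum_p P l p * K p q = (l == q)%:R.
  by have /matrixP/(_ l q) := PK; rewrite !mxE.
have delta_sum (F : 'I_m -> R) q : \sum_l (l == q)%:R * F l = F q.
  rewrite (bigD1 q)//= eqxx mul1r big1 ?addr0// => l /negPf ->.
  by rewrite mul0r.
have t1 : \sum_p \sum_l P p b * S l a * K l p = S a b.
  rewrite exchange_big -SE -(delta_sum (fun l => S l a)); apply: eq_bigr => l _.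
  by rewrite -KPE mulr_suml; apply: eq_bigr => p _; ring.
have t2 : \sum_p \sum_l P p l * S b a * K l p = m%:R * S a b.
  rewrite (eq_bigr (fun=> S b a)) => [|p _]; last first.
    transitivity ((\sum_l P p l * K l p) * S b a); last by rewrite PKE eqxx mul1r.
    by rewrite mulr_suml; apply: eq_bigr => l _; ring.
  by rewrite sumr_const card_ord mulr_natl (SE a b).
have t3 : \sum_p \sum_l P a b * S l p * K l p = 0.
  transitivity (- P a b * \tr (S *m K)); last by rewrite mxtrace_sym_skew ?mulr0.
  rewrite exchange_big mulr_sumr; apply: eq_bigr => l _.
  rewrite mxE mulr_sumr; apply: eq_bigr => p _.
  by have /matrixP/(_ l p) := KN; rewrite !mxE => ->; ring.
have t4 : \sum_p \sum_l P a l * S b p * K l p = S a b.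
  rewrite -SE -(delta_sum (fun p => S b p)); apply: eq_bigr => p _.
  rewrite eq_sym -PKE mulr_suml; apply: eq_bigr => l _; ring.
have t5 : \sum_p \sum_l P p a * S b l * K l p = S a b.
  rewrite exchange_big -SE -(delta_sum (fun l => S b l)); apply: eq_bigr => l _.
  by rewrite -KPE mulr_suml; apply: eq_bigr => p _; ring.
have -> : \sum_p \sum_l model_curv P S p a b l * K l p =
    2^-1 * (\sum_p \sum_l P p b * S l a * K l p
            + \sum_p \sum_l P p l * S b a * K l p)
    - 2^-1 * (\sum_p \sum_l P a b * S l p * K l p
            + \sum_p \sum_l P a l * S b p * K l p)
    + \sum_p \sum_l P p a * S b l * K l p.
  rewrite -!big_split !mulr_sumr -sumrB -big_split; apply: eq_bigr => p _.
  rewrite -!big_split !mulr_sumr -sumrB -big_split; apply: eq_bigr => l _ /=.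
  by rewrite /model_curv; ring.
by rewrite t1 t2 t3 t4 t5 -addn2 natrD; field.
Qed.

End Form4.

(** * Curvature determined by sectional curvature *)

Section ModelDerivative.
Variables (R : realType) (m : nat).
Local Notation rV := 'rV[R]_m.
Variables (e : 'I_m) (x : rV).

(** The derivative of a compound expression is computed together with its
    differentiability, so that the two need not be established separately. *)
Definition has_pderiv (f : rV -> R) (l : R) := differentiable f x /\ pderiv e f x = l.

Lemma has_pderivD f g l k : has_pderiv f l -> has_pderiv g k ->
  has_pderiv (fun z => f z + g z) (l + k).
Proof. by move=> [df <-] [dg <-]; split; [exact: differentiableD|rewrite pderivD]. Qed.

Lemma has_pderivM f g l k : has_pderiv f l -> has_pderiv g k ->
  has_pderiv (fun z => f z * g z) (l * g x + f x * k).
Proof. by move=> [df <-] [dg <-]; split; [exact: differentiableM|rewrite pderivM]. Qed.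

Lemma has_pderivZ c f l : has_pderiv f l -> has_pderiv (fun z => c * f z) (c * l).
Proof. by move=> [df <-]; split; [exact: differentiableZ|rewrite pderivZ]. Qed.

Lemma has_pderivN f l : has_pderiv f l -> has_pderiv (fun z => - f z) (- l).
Proof. by move=> [df <-]; split; [exact: differentiableN|rewrite pderivN]. Qed.

Lemma sum_model_terms (F g A B C D E : 'I_m -> R) (p q r s t : R) :
  (forall k, F k = g k *
    (2^-1 * (A k * p + B k * q) - 2^-1 * (C k * r + D k * s) + E k * t)) ->
  \sum_k F k =
  2^-1 * ((\sum_k g k * A k) * p + (\sum_k g k * B k) * q)
  - 2^-1 * ((\sum_k g k * C k) * r + (\sum_k g k * D k) * s)
  + (\sum_k g k * E k) * t.
Proof.
move=> FE; rewrite !mulr_suml -!big_split !mulr_sumr -sumrB -big_split.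
by apply: eq_bigr => k _ /=; rewrite FE; ring.
Qed.

(** By the Leibniz rule the connection acts on a product of entries of parallel
    tensors by acting on one index at a time. *)
Lemma model_curv_parallel (P S : rV -> 'M[R]_m) (G : 'M[R]_m) a b c d :
  mdifferentiable P x -> mdifferentiable S x ->
  mderiv e P x = G *m P x + P x *m G^T -> mderiv e S x = G *m S x + S x *m G^T ->
  has_pderiv (fun z => model_curv (P z) (S z) a b c d)
  (\sum_p G a p * model_curv (P x) (S x) p b c d
  + \sum_p G b p * model_curv (P x) (S x) a p c d
  + \sum_p G c p * model_curv (P x) (S x) a b p d
  + \sum_p G d p * model_curv (P x) (S x) a b c p).
Proof.
move=> dP dS pP pS.
have hP p q : has_pderiv (fun z => P z p q)
    (\sum_k G p k * P x k q + \sum_k G q k * P x p k).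
  split=> //; rewrite -mderivE pP 3!mxE; congr (_ + _); apply: eq_bigr => k _.
  by rewrite mxE mulrC.
have hS p q : has_pderiv (fun z => S z p q)
    (\sum_k G p k * S x k q + \sum_k G q k * S x p k).
  split=> //; rewrite -mderivE pS 3!mxE; congr (_ + _); apply: eq_bigr => k _.
  by rewrite mxE mulrC.
have h := has_pderivD (has_pderivD
   (has_pderivZ 2^-1 (has_pderivD (has_pderivM (hP a c) (hS d b))
                                  (has_pderivM (hP a d) (hS c b))))
   (has_pderivN (has_pderivZ 2^-1 (has_pderivD (has_pderivM (hP b c) (hS d a))
                                  (has_pderivM (hP b d) (hS c a))))))
   (has_pderivM (hP a b) (hS c d)).
split; first exact: h.1.
rewrite [LHS]h.2 {h hP hS}.
(* Each of the four sums lets the connection act on one index of the model; it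
   is distributed over the entries of [P] and [S] carrying that index. *)
rewrite (@sum_model_terms
    (fun p => G a p * model_curv (P x) (S x) p b c d) (G a)
    (P x ^~ c) (P x ^~ d) (S x d) (S x c) (P x ^~ b)
    (S x d b) (S x c b) (P x b c) (P x b d) (S x c d)) => [|k];
  last by rewrite /model_curv; ring.
rewrite (@sum_model_terms
    (fun p => G b p * model_curv (P x) (S x) a p c d) (G b)
    (S x d) (S x c) (P x ^~ c) (P x ^~ d) (P x a)
    (P x a c) (P x a d) (S x d a) (S x c a) (S x c d)) => [|k];
  last by rewrite /model_curv; ring.
rewrite (@sum_model_terms
    (fun p => G c p * model_curv (P x) (S x) a b p d) (G c)
    (P x a) (S x ^~ b) (P x b) (S x ^~ a) (S x ^~ d)
    (S x d b) (P x a d) (S x d a) (P x b d) (P x a b)) => [|k];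
  last by rewrite /model_curv; ring.
rewrite (@sum_model_terms
    (fun p => G d p * model_curv (P x) (S x) a b c p) (G d)
    (S x ^~ b) (P x a) (S x ^~ a) (P x b) (S x c)
    (P x a c) (S x c b) (P x b c) (S x c a) (P x a b)) => [|k];
  last by rewrite /model_curv; ring.
ring.
Qed.

End ModelDerivative.

Section Sectional.
Variables (R : realType) (m : nat) (M : smooth_manifold R m).
Variables (nabla : affine_connection M) (Omega : symplectic_form M).
Hypothesis symp : symplectic_connection nabla Omega.
Implicit Types (i j : chart_idx M) (x X Y Z W : 'rV[R]_m) (a b c d e : 'I_m).

Lemma bilin_Rm i x X Y Z W :
  bilin Omega i x (Rm_at nabla i x X Y Z) W =
  form4_at (Rm_low nabla Omega i x) X Y Z W.
Proof.
rewrite /bilin.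
under eq_bigr => p _ do under eq_bigr => d _ do rewrite mxE !mulr_suml.
rewrite /form4_at.
under eq_bigr => p _ do rewrite exchange_big /=.
rewrite exchange_big; apply: eq_bigr => a _ /=.
under eq_bigr => p _ do under eq_bigr => d _ do rewrite !mulr_suml.
under eq_bigr => p _ do rewrite exchange_big /=.
rewrite exchange_big; apply: eq_bigr => b _ /=.
under eq_bigr => p _ do under eq_bigr => d _ do rewrite !mulr_suml.
under eq_bigr => p _ do rewrite exchange_big /=.
rewrite exchange_big; apply: eq_bigr => c _ /=.
rewrite exchange_big; apply: eq_bigr => d _ /=.
by rewrite /Rm_low mulr_sumr; apply: eq_bigr => p _; ring.
Qed.

Lemma form_nondegenerate_pair i x X : coord_dom i x -> X != 0 ->
  exists Y, bilin Omega i x X Y != 0.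
Proof.
move=> ix X0; have Ou := form2_nondegenerate Omega ix.
have : X *m Omega i x != 0.
  by apply: contra_neq X0 => X0; rewrite -(mulmxK Ou X) X0 mul0mx.
case/rV0Pn => b Xb; exists (delta_mx 0 b); apply: contra_neq Xb => Xb.
rewrite -[RHS]Xb /bilin exchange_big mxE.
rewrite -(sum_delta_row b (fun b => \sum_a X 0 a * Omega i x a b)).
by apply: eq_bigr => b' _; rewrite mulr_sumr; apply: eq_bigr => a _; ring.
Qed.

Lemma bilin_self i x X : coord_dom i x -> bilin Omega i x X X = 0.
Proof. by move=> ix; have := bilin_skew Omega X X ix; lra. Qed.

Lemma span_pair X Y Z : Z \in <<[:: X; Y]>>%VS -> exists s t, Z = s *: X + t *: Y.
Proof.
rewrite span_cons span_seq1 => /memv_addP[_ /vlineP[s ->] [_ /vlineP[t ->] ->]].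
by exists s, t.
Qed.

Lemma symplectic_pair i x X Y : coord_dom i x -> bilin Omega i x X Y != 0 ->
  basis_of <<[:: X; Y]>>%VS [:: X; Y] /\ symplectic_plane Omega i x <<[:: X; Y]>>%VS.
Proof.
move=> ix XY0.
have XX := bilin_self X ix; have YY := bilin_self Y ix.
have YX := bilin_skew Omega X Y ix.
have coef0 s t : bilin Omega i x (s *: X + t *: Y) X = 0 ->
    bilin Omega i x (s *: X + t *: Y) Y = 0 -> s *: X + t *: Y = 0.
  rewrite !bilinDl XX YY YX !mulr0 add0r addr0 mulrN => /eqP.
  rewrite oppr_eq0 mulf_eq0 (negPf XY0) orbF => /eqP -> /eqP.
  by rewrite mulf_eq0 (negPf XY0) orbF => /eqP ->; rewrite !scale0r addr0.
have freeXY : free [:: X; Y].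
  rewrite free_cons span_seq1 seq1_free; apply/andP; split.
    apply/negP => /vlineP[k XE]; move: XY0.
    have -> : X = k *: Y + 0 *: Y by rewrite scale0r addr0.
    by rewrite bilinDl YY !mulr0 addr0 eqxx.
  apply: contra_neq XY0 => Y0.
  have -> : Y = 0 *: X + 0 *: X by rewrite Y0 !scale0r addr0.
  by rewrite bilinDr !mul0r addr0.
split; first by rewrite /basis_of eqxx.
split; first by move/eqP: freeXY.
move=> _ /span_pair[s [t ->]] H; apply: coef0; apply: H; apply: memv_span.
  by rewrite inE eqxx.
by rewrite !inE eqxx orbT.
Qed.

Section Constant.
Variables (i : chart_idx M) (x : 'rV[R]_m) (S : 'M[R]_m).
Hypotheses (ix : coord_dom i x) (S_sym : S^T = S).

(** The sectional curvatures prescribe R(X, Y, X, X) whenever X and Y pair to a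
    nonzero number. Linearity in Y extends this to all pairs, since those Y span,
    and the difference with the model is then killed by [curvature_like_eq0]. *)
Lemma Rm_low_of_constant :
  (forall L, symplectic_plane Omega i x L -> forall Z, Z \in L ->
     plane_curvature nabla Omega i x L Z = form2_at S Z Z) ->
  forall a b c d, Rm_low nabla Omega i x a b c d =
    2^-1 * model_curv (Omega i x) S a b c d.
Proof.
move=> secE.
pose om := form2_at (Omega i x).
have omN X Y : om Y X = - om X Y by exact: bilin_skew.
have om0 X : om X X = 0 by exact: bilin_self.
pose Rf := form4_at (Rm_low nabla Omega i x).
have gen X Y : om X Y != 0 -> Rf X Y X X = om X Y * form2_at S X X.
  move=> XY0; have [bas pl] := symplectic_pair ix XY0.
  rewrite -(secE _ pl); last by apply: memv_span; rewrite inE eqxx.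
  by rewrite (plane_curvatureE _ _ ix pl bas) mulrC divfK// /Rf bilin_Rm.
pose T a b c d := Rm_low nabla Omega i x a b c d
  + (- 2^-1) * model_curv (Omega i x) S a b c d.
have TE X Y Z W : form4_at T X Y Z W =
    Rf X Y Z W + (- 2^-1) * form4_at (model_curv (Omega i x) S) X Y Z W.
  by rewrite form4D form4Z.
have ON := form2_tr Omega ix.
have T_diag0 X Y : om X Y != 0 -> form4_at T X Y X X = 0.
  move=> XY0; rewrite TE gen// form4_model -/om om0 (omN X Y); lra.
have skew a b c d : T b a c d = - T a b c d.
  by rewrite /T Rm_low_skew model_curv_skew//; ring.
have skewf X Y Z W : form4_at T Y X Z W = - form4_at T X Y Z W.
  rewrite form4_swap12 -mulN1r -form4Z; apply: eq_form4 => a b c d.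
  by rewrite skew mulN1r.
have add2 X Y Y' Z W :
    form4_at T X (Y + Y') Z W = form4_at T X Y Z W + form4_at T X Y' Z W.
  by rewrite skewf form4_add1 opprD -!skewf.
have T_diag X Y : form4_at T X Y X X = 0.
  have [XY0|] := eqVneq (om X Y) 0; last exact: T_diag0.
  have [X0|/(form_nondegenerate_pair ix)[Y' XY'0]] := eqVneq X 0.
    have := form4_add1 T 0 0 Y X X; rewrite addr0 -X0; lra.
  have XYY' : om X (Y + Y') != 0.
    have omD : om X (Y + Y') = om X Y + om X Y'.
      by have := bilinDr Omega i x 1 1 Y Y' X; rewrite !scale1r !mul1r.
    by rewrite omD XY0 add0r.
  by have := T_diag0 _ _ XYY'; rewrite add2 (T_diag0 _ _ XY'0) addr0.
have T0 : forall X Y Z W, form4_at T X Y Z W = 0.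
  apply: curvature_like_eq0 => //.
  - exact: form4_add1.
  - exact: form4_add3.
  - move=> X Y Z W; rewrite [RHS]form4_swap34; apply: eq_form4 => a b c d.
    by rewrite /T (Rm_low_sym symp)// (model_curv_sym _ _ _ _ _ S_sym).
  move=> X Y Z W.
  rewrite (form4_cycle T X Y Z) (form4_cycle T Y Z X) (form4_cycle _ X Y Z).
  rewrite -!form4D -[RHS](form4_0 X Y Z W); apply: eq_form4 => a b c d.
  have := Rm_low_bianchi symp a b c d ix.
  have := model_curv_bianchi a b c d ON S_sym; rewrite /T; lra.
move=> a b c d; have := T0 (delta_mx 0 a) (delta_mx 0 b) (delta_mx 0 c) (delta_mx 0 d).
by rewrite form4_delta /T; lra.
Qed.

End Constant.
End Sectional.

(** * Connections whose curvature is a model tensor *)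

Section ModelCurvature.
Variables (R : realType) (m : nat) (M : smooth_manifold R m).
Variables (nabla : affine_connection M) (Omega : symplectic_form M).
Hypothesis symp : symplectic_connection nabla Omega.
Implicit Types (i j : chart_idx M) (x X Y Z W : 'rV[R]_m) (a b c d e : 'I_m).

Lemma symplectic_plane_basis i x L : coord_dom i x -> symplectic_plane Omega i x L ->
  exists X Y, basis_of L [:: X; Y] /\ bilin Omega i x X Y != 0.
Proof.
move=> ix [dimL rad]; have := vbasisP L; move: (vbasis L); rewrite dimL.
case=> -[|X [|Y []]] //= _ bas; exists X, Y; split=> //.
have /andP[/eqP spanXY freeXY] := bas.
apply/eqP => XY0.
have X0 : X = 0.
  apply: rad; first by rewrite -spanXY memv_span// inE eqxx.
  move=> V; rewrite -spanXY => /span_pair[s [t ->]].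
  by rewrite bilinDr XY0 bilin_self// !mulr0 addr0.
by have := free_not0 freeXY (mem_head X [:: Y]); rewrite X0 eqxx.
Qed.

Section AtPoint.
Variables (i : chart_idx M) (x : 'rV[R]_m) (S : 'M[R]_m) (k : R).
Hypotheses (ix : coord_dom i x) (S_sym : S^T = S).
Hypothesis low_model : forall a b c d,
  Rm_low nabla Omega i x a b c d = k * model_curv (Omega i x) S a b c d.

Lemma ricci_of_model a b : ricci nabla i x a b = k * (m.+2%:R / 2 * S a b).
Proof.
rewrite -(model_curv_trace _ _ (form2_nondegenerate Omega ix)) ?form2_tr//.
rewrite mxE mulr_sumr; apply: eq_bigr => p _; rewrite mulr_sumr.
have /matrixP/(_ b p) := curv_mx_low nabla Omega p a ix.
rewrite mxE => ->; rewrite mxE; apply: eq_bigr => l _.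
by rewrite mxE low_model mulrA.
Qed.

(** If Z = s X + t Y then om(X, Z) = t om(X, Y) and om(Y, Z) = - s om(X, Y), so
    that the mixed terms of the model add up to a second copy of
    om(X, Y) S(Z, Z). *)
Lemma sectional_of_model L Z : symplectic_plane Omega i x L -> Z \in L ->
  plane_curvature nabla Omega i x L Z = k * (2 * form2_at S Z Z).
Proof.
move=> pl ZL; have [X [Y [bas XY0]]] := symplectic_plane_basis ix pl.
rewrite (plane_curvatureE nabla Z ix pl bas).
have /andP[/eqP spanXY _] := bas.
have := ZL; rewrite -spanXY => /span_pair[s [t ZE]].
pose om := form2_at (Omega i x).
have XYE : bilin Omega i x X Y = om X Y by [].
have lowE : bilin Omega i x (Rm_at nabla i x X Y Z) Z =
    k * form4_at (model_curv (Omega i x) S) X Y Z Z.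
  by rewrite bilin_Rm -form4Z; exact: eq_form4.
have XZ : om X Z = t * om X Y.
  by rewrite ZE [LHS](bilinDr Omega) bilin_self// mulr0 add0r.
have YZ : om Y Z = - (s * om X Y).
  rewrite ZE [LHS](bilinDr Omega) (bilin_self Omega Y ix) mulr0 addr0.
  by rewrite (bilin_skew Omega X Y ix) mulrN.
have SZ : form2_at S Z Z = s * form2_at S Z X + t * form2_at S Z Y.
  by rewrite {2}ZE; exact: (bilinDr (fun _ _ => S) i x).
rewrite lowE form4_model -/om XZ YZ XYE SZ; rewrite XYE in XY0.
by field.
Qed.

End AtPoint.

Lemma cov_deriv_curv_mx i x e a b :
  \matrix_(c, d) cov_deriv_Rm nabla i x e a b c d =
  mderiv e (curv_mx nabla i a b) x
  - \sum_p conn_mx nabla i e x a p *: curv_mx nabla i p b x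
  - \sum_p conn_mx nabla i e x b p *: curv_mx nabla i a p x
  - conn_mx nabla i e x *m curv_mx nabla i a b x
  + curv_mx nabla i a b x *m conn_mx nabla i e x.
Proof.
apply/matrixP => c d.
have mE (A B C D E : 'M[R]_m) : (A - B - C - D + E) c d =
    A c d - B c d - C c d - D c d + E c d by rewrite !mxE.
rewrite [LHS]mxE [RHS]mE.
congr (_ - _ - _ - _ + _).
- rewrite mderivE; have -> // : (fun z => curv_mx nabla i a b z c d) =
    (fun z => Rm nabla i z a b c d) by apply/funext => z; rewrite mxE.
- by rewrite summxE; apply: eq_bigr => p _; rewrite !mxE.
- by rewrite summxE; apply: eq_bigr => p _; rewrite !mxE.
- by rewrite mxE; apply: eq_bigr => p _; rewrite !mxE.
by rewrite mxE; apply: eq_bigr => p _; rewrite !mxE mulrC.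
Qed.

(** The lowered curvature is built from parallel tensors, hence parallel; since
    the symplectic form used to lower the index is parallel and invertible, the
    curvature itself is parallel. *)
Lemma locally_symmetric_of_model (k : R) (S : cov2_tensor M) :
  (forall i x, coord_dom i x -> forall a b c d,
    Rm_low nabla Omega i x a b c d = k * model_curv (Omega i x) (S i x) a b c d) ->
  parallel2 nabla S -> locally_symmetric nabla.
Proof.
move=> low pS i x ix e a b c d.
have [_ /parallel2P pO] := symp; move/parallel2P in pS.
suff : \matrix_(c, d) cov_deriv_Rm nabla i x e a b c d = 0.
  by move=> /matrixP/(_ c d); rewrite !mxE.
have Ou := form2_nondegenerate Omega ix.
rewrite -[LHS](mulmxK Ou) -[RHS](mul0mx _ (invmx (Omega i x))); congr (_ *m _).
set G := conn_mx nabla i e x.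
pose low_mx a b z : 'M[R]_m := curv_mx nabla i a b z *m Omega i z.
have dcurv : mdifferentiable (curv_mx nabla i a b) x.
  move=> p q; have -> : (fun z => curv_mx nabla i a b z p q) =
      (fun z => Rm nabla i z a b p q) by apply/funext => z; rewrite mxE.
  exact: smooth_on_differentiable (@Rm_smooth _ _ _ nabla i a b p q) ix.
have dO : mdifferentiable (Omega i) x.
  by move=> p q; exact: smooth_on_differentiable (@comp2_smooth _ _ _ Omega i p q) ix.
have dS : mdifferentiable (S i) x.
  by move=> p q; exact: smooth_on_differentiable (@comp2_smooth _ _ _ S i p q) ix.
(* Lowering an index commutes with the covariant derivative, as Omega is
   parallel. *)
have -> : (\matrix_(c, d) cov_deriv_Rm nabla i x e a b c d) *m Omega i x =
    mderiv e (low_mx a b) x - \sum_p G a p *: low_mx p b x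
    - \sum_p G b p *: low_mx a p x - G *m low_mx a b x - low_mx a b x *m G^T.
  have dlow : mderiv e (low_mx a b) x =
      mderiv e (curv_mx nabla i a b) x *m Omega i x
      + curv_mx nabla i a b x *m (G *m Omega i x + Omega i x *m G^T).
    by rewrite [LHS](mderivM e dcurv dO) (pO i x ix).
  have sumE (g : 'I_m -> R) (F : 'I_m -> 'M[R]_m) :
      (\sum_p g p *: F p) *m Omega i x = \sum_p g p *: (F p *m Omega i x).
    by rewrite mulmx_suml; apply: eq_bigr => p _; rewrite scalemxAl.
  have expand (A B C D E O : 'M[R]_m) : (A - B - C - D + E) *m O =
      A *m O - B *m O - C *m O - D *m O + E *m O by rewrite !mulmxDl !mulNmx.
  have collect (D S1 S2 C O : 'M[R]_m) :
      D *m O - S1 - S2 - G *m C *m O + C *m G *m O =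
      D *m O + C *m (G *m O + O *m G^T) - S1 - S2 - G *m (C *m O) - C *m O *m G^T.
    rewrite mulmxDr !mulmxA; move: (D *m O) (_ *m _ *m O) (_ *m _ *m O) (_ *m G^T).
    move=> A1 A2 A3 A4; apply/matrixP => p q; rewrite !mxE; ring.
  rewrite (cov_deriv_curv_mx i x e a b).
  rewrite [LHS]expand.
  rewrite dlow.
  rewrite [X in _ - X - _ - _ + _ = _]sumE.
  rewrite [X in _ - _ - X - _ + _ = _]sumE.
  exact: collect.
apply/matrixP => c' d'; rewrite [RHS]mxE.
have mE (A B C D E : 'M[R]_m) : (A - B - C - D - E) c' d' =
    A c' d' - B c' d' - C c' d' - D c' d' - E c' d' by rewrite !mxE.
have lowE z p q r s : coord_dom i z ->
    low_mx p q z r s = k * model_curv (Omega i z) (S i z) p q r s.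
  by move=> iz; rewrite /low_mx -Rm_lowE low.
have [dmodel modelE] := model_curv_parallel a b c' d' dO dS (pO _ _ ix e) (pS _ _ ix e).
have E1 : mderiv e (low_mx a b) x c' d' =
    k * pderiv e (fun z => model_curv (Omega i z) (S i z) a b c' d') x.
  rewrite mderivE -pderivZ//.
  by apply: (pderiv_ext e (coord_dom_open i) _ ix) => z /set_mem iz; exact: lowE.
have E2 : (\sum_p G a p *: low_mx p b x) c' d' =
    k * \sum_p G a p * model_curv (Omega i x) (S i x) p b c' d'.
  rewrite summxE mulr_sumr; apply: eq_bigr => p _.
  by rewrite mxE lowE// mulrCA.
have E3 : (\sum_p G b p *: low_mx a p x) c' d' =
    k * \sum_p G b p * model_curv (Omega i x) (S i x) a p c' d'.
  rewrite summxE mulr_sumr; apply: eq_bigr => p _.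
  by rewrite mxE lowE// mulrCA.
have E4 : (G *m low_mx a b x) c' d' =
    k * \sum_p G c' p * model_curv (Omega i x) (S i x) a b p d'.
  by rewrite mxE mulr_sumr; apply: eq_bigr => p _; rewrite lowE// mulrCA.
have E5 : (low_mx a b x *m G^T) c' d' =
    k * \sum_p G d' p * model_curv (Omega i x) (S i x) a b c' p.
  rewrite mxE mulr_sumr; apply: eq_bigr => p _; rewrite lowE//.
  by rewrite [_^T _ _]mxE -mulrA [X in _ * X = _]mulrC.
rewrite modelE in E1; apply: etrans (mE _ _ _ _ _) _.
have fin (t1 t2 t3 t4 t5 u2 u3 u4 u5 : R) :
    t1 = k * (u2 + u3 + u4 + u5) -> t2 = k * u2 -> t3 = k * u3 -> t4 = k * u4 ->
    t5 = k * u5 -> t1 - t2 - t3 - t4 - t5 = 0.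
  by move=> -> -> -> -> ->; ring.
exact: fin E1 E2 E3 E4 E5.
Qed.

End ModelCurvature.

(** * Weyl flatness and constant sectional curvature *)

Section Tensors.
Variables (R : realType) (m : nat) (M : smooth_manifold R m).
Implicit Types (i j : chart_idx M) (x : 'rV[R]_m) (a b : 'I_m).

Section Scale.
Variables (k : R) (T : cov2_tensor M).

Let scale_smooth i a b :
  smooth_on (coord_dom i) (fun x => (k *: T i x : 'M[R]_m) a b).
Proof.
have -> : (fun x => (k *: T i x : 'M[R]_m) a b) = fun x => k * T i x a b.
  by apply/funext => x; rewrite mxE.
by apply: smooth_onZ; [exact: coord_dom_open|exact: comp2_smooth].
Qed.

Let scale_change i j x : overlap i j x -> forall a b,
  (k *: T i x : 'M[R]_m) a b = \sum_c \sum_d jac i j x a c * jac i j x b d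
    * (k *: T j (transition i j x) : 'M[R]_m) c d.
Proof.
move=> ijx a b; rewrite mxE (comp2_change T ijx) mulr_sumr; apply: eq_bigr => c _.
by rewrite mulr_sumr; apply: eq_bigr => d _; rewrite mxE mulrCA.
Qed.

Definition cov2_scale : cov2_tensor M := Cov2Tensor scale_smooth scale_change.

End Scale.

Section Ricci.
Variables (nabla : affine_connection M) (Omega : symplectic_form M).

Let ricci_smooth i a b :
  smooth_on (coord_dom i) (fun x => ricci nabla i x a b).
Proof.
have -> : (fun x => ricci nabla i x a b) = fun x => \sum_p Rm nabla i x p a b p.
  by apply/funext => x; rewrite mxE.
by apply: smooth_on_sum => [|p]; [exact: coord_dom_open|exact: Rm_smooth].
Qed.

Definition ricci_tensor : cov2_tensor M :=
  Cov2Tensor ricci_smooth (ricci_change nabla Omega).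

End Ricci.
End Tensors.

Section Main.
Variables (R : realType) (n : nat) (M : smooth_manifold R (2 * n)).
Variables (nabla : affine_connection M) (Omega : symplectic_form M).
Hypothesis symp : symplectic_connection nabla Omega.

Lemma half_dim_succ : ((2 * n).+2%:R : R) = 2 * n.+1%:R.
Proof. by rewrite -natrM mulnS add2n. Qed.

Lemma succ_neq0 : (n.+1%:R : R) != 0.
Proof. by rewrite pnatr_eq0. Qed.

Lemma weyl_flat_low : weyl_flat nabla Omega -> forall i x, coord_dom i x ->
  forall a b c d, Rm_low nabla Omega i x a b c d =
    n.+1%:R^-1 * model_curv (Omega i x) (ricci_tensor nabla Omega i x) a b c d.
Proof. by move=> wf i x ix a b c d; have /subr0_eq := wf i x ix a b c d. Qed.

(** Constant curvature [A] makes the lowered curvature one half of the model of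
    [A]; contracting identifies the Ricci tensor with a multiple of [A], which
    therefore is parallel and rebuilds the curvature. *)
Lemma constant_weyl_flat : constant_symplectic_sectional_curvature nabla Omega ->
  weyl_flat nabla Omega /\ parallel2 nabla (ricci nabla).
Proof.
move=> [A [Asym pA secA]].
have AT i x : coord_dom i x -> (A i x)^T = A i x.
  by move=> ix; apply/matrixP => a b; rewrite mxE Asym.
have low i x (ix : coord_dom i x) := Rm_low_of_constant symp ix (AT i x ix) (secA i x ix).
have ricE i x : coord_dom i x -> ricci nabla i x = (n.+1%:R / 2) *: A i x.
  move=> ix; apply/matrixP => a b.
  rewrite (ricci_of_model ix (AT i x ix) (low i x ix)) half_dim_succ [RHS]mxE.
  by field.
split; last exact: parallel2_scale ricE pA.
move=> i x ix a b c d; rewrite /symplectic_weyl low// ricE//.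
have n0 := succ_neq0.
by rewrite /model_curv !mxE; field.
Qed.

(** Weyl flatness makes 2/(n + 1) Ric give the sectional curvatures; it is a
    tensor field because the Ricci tensor is one. *)
Lemma weyl_flat_constant : weyl_flat nabla Omega -> parallel2 nabla (ricci nabla) ->
  constant_symplectic_sectional_curvature nabla Omega.
Proof.
move=> wf pR; exists (cov2_scale (2 / n.+1%:R) (ricci_tensor nabla Omega)); split.
- move=> i x ix a b /=; rewrite !mxE; congr (_ * _).
  by have := ricci_sym symp a b ix; rewrite !mxE.
- exact: (parallel2_scale (T := ricci_tensor nabla Omega) (c := 2 / n.+1%:R)).
move=> i x ix L pl Z ZL.
rewrite (sectional_of_model ix (weyl_flat_low wf ix) pl ZL).
rewrite /bilin /form2_at !mulr_sumr; apply: eq_bigr => a _.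
rewrite !mulr_sumr; apply: eq_bigr => b _ /=.
by rewrite [in RHS]mxE; ring.
Qed.

Lemma weyl_flat_locally_symmetric : weyl_flat nabla Omega ->
  parallel2 nabla (ricci nabla) -> locally_symmetric nabla.
Proof.
move=> wf pR; apply: (locally_symmetric_of_model symp (S := ricci_tensor nabla Omega)) => //.
exact: weyl_flat_low.
Qed.

End Main.

Theorem corollary4p1 (R : realType) (n : nat) (n_gt0 : (0 < n)%N)
    (M : smooth_manifold R (2 * n)) (Omega : symplectic_form M)
    (nabla : affine_connection M) :
  symplectic_connection nabla Omega ->
  (constant_symplectic_sectional_curvature nabla Omega <->
     weyl_flat nabla Omega /\ parallel2 nabla (ricci nabla))
  /\ (constant_symplectic_sectional_curvature nabla Omega ->
        locally_symmetric nabla).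
Proof.
move=> symp; have fwd := constant_weyl_flat symp; split; first split=> //.
  by move=> [wf pR]; exact: weyl_flat_constant.
by move=> /fwd[wf pR]; exact: weyl_flat_locally_symmetric wf pR.
Qed.
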